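(* Let $\mathfrak{s}$ be an unlabeled scheme with $n$ vertices, $\nu$ a consistent naming of its vertices, and $\pi:\{1,\dots,n\}\to V(\mathfrak{s})$ a bijection; let $\overline{\pi}(k)=\pi(n+1-k)$. Then the univariate series $R^{\pi}_{\mathfrak{s},\nu}(t)$, viewed as a function of $D$, is a rational function of $D$, and $R^{\overline{\pi}}_{\mathfrak{s},\nu}(1/D)=R^{\pi}_{\mathfrak{s},\nu}(D)$.
   Context: Blossoming maps: maps (cellular embeddings of connected graphs in compact orientable surfaces, given by counterclockwise cyclic orders at vertices) with extra stems, each a leaf (towards its vertex) or a bud (away); interior degree ignores stems, degree counts them; 4-valent = all degrees $4$. Rooted: a marked root bud; root corner = corner preceding it counterclockwise. For rooted unicellular blossoming maps: clockwise contour = cyclic sequence of corners and stems along the face from the root corner with the face on the right; canonical labeling: root corner $0$, next corner keeps label across an edge traversal, $+1$ across a bud, $-1$ across a leaf. Well-oriented: each edge oriented opposite to its first contour traversal. Well-labeled: corners on the same side of an edge have equal labels, consecutive corners around a vertex differ by $1$ with the larger on the left of the separating edge or stem. $\mathcal{R}$: rooted unicellular blossoming maps, all vertices of interior degree $\ge2$, 4-valent, well-oriented, well-labeled, with root bud at a vertex of interior degree $\ge3$ (scheme vertex). Labeled scheme of $\mathfrak{r}\in\mathcal{R}$: delete the vertices of interior degree $2$ with their stems, replacing each maximal path of them by one edge (inheriting the common orientation); corners at scheme vertices keep their labels. Forgetting labels gives the unlabeled scheme. Height $h(v)$ of a vertex = minimum label of its corners; relative label = label minus height (in $\{0,1,2\}$,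 depending only on the unlabeled scheme). A half-edge has type $0$ if its adjacent corners have relative labels $0,1$, type $1$ if $1,2$. Edge $\{u,v\}$ offset toward $v$: type $0$ at $u$, type $1$ at $v$. A naming is a bijection $\nu:V(\mathfrak{s})\to\{1,\dots,n\}$, consistent if $\nu(u)<\nu(v)$ whenever $\{u,v\}$ is offset toward $v$. Height order: the bijection $\{1,\dots,n\}\to V$ listing vertices by increasing lexicographic $(h(v),\nu(v))$. $\mathcal{R}^{\pi}_{\mathfrak{s},\nu}$: elements of $\mathcal{R}$ with unlabeled scheme $\mathfrak{s}$ and height order $\pi$. Univariate series: $R^{\pi}_{\mathfrak{s},\nu}(t)=\sum_{\mathfrak{r}\in\mathcal{R}^{\pi}_{\mathfrak{s},\nu}}t^{(\text{number of leaves of }\mathfrak{r})+1}$. $D(t)$ is the power series without constant term with $D=t+4tD+tD^2$, so that $t=D/(1+4D+D^2)$; series in $t$ are viewed as functions of $D$ through this substitution. *)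

(* Defs.v *)
From HB Require Import structures.
From mathcomp Require Import all_boot all_order all_fingroup all_algebra.
From mathcomp Require Import generic_quotient fraction classical_sets fsbigop.

Set Implicit Arguments.
Unset Strict Implicit.
Unset Printing Implicit Defensive.

Import Order.TTheory GRing.Theory Num.Theory.
Local Open Scope ring_scope.

(** * Rooted oriented blossoming maps *)

(* A map is given by its half-edges (stems included): [rot] sends a half-edge
   to the next one counterclockwise around its vertex, [mate] exchanges the two
   halves of an edge and fixes the stems, [out] is the set of half-edges
   directed away from their vertex, so that a bud is an outgoing stem and a
   leaf an ingoing one.  The vertices are the orbits of [rot].
   The corner between [h] and [rot r h] is represented by [h]. *)
Record bmap (H : finType) := BMap {
  rot : {perm H};
  mate : {perm H};
  out : {set H};
  root : H }.

Definition bmap_tuple (H : finType) (r : bmap H) :=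
  (rot r, mate r, out r, root r).
Definition tuple_bmap (H : finType) (x : {perm H} * {perm H} * {set H} * H) :=
  let: (s, a, o, b) := x in BMap s a o b.
Lemma bmap_tupleK (H : finType) : cancel (@bmap_tuple H) (@tuple_bmap H).
Proof. by case. Qed.
HB.instance Definition _ (H : finType) :=
  Finite.copy (bmap H) (can_type (@bmap_tupleK H)).

Definition is_stem (H : finType) (r : bmap H) (h : H) : bool := mate r h == h.
Definition is_bud (H : finType) (r : bmap H) (h : H) : bool :=
  is_stem r h && (h \in out r).
Definition is_leaf (H : finType) (r : bmap H) (h : H) : bool :=
  is_stem r h && (h \notin out r).
Definition n_leaves (H : finType) (r : bmap H) : nat := #|[set h | is_leaf r h]|.

(* Degree and interior degree of the vertex carrying the half-edge [h]. *)
Definition degree (H : finType) (r : bmap H) (h : H) : nat :=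
  #|porbit (rot r) h|.
Definition interior_degree (H : finType) (r : bmap H) (h : H) : nat :=
  #|[set g in porbit (rot r) h | ~~ is_stem r g]|.

Definition rooted_blossoming_map (H : finType) (r : bmap H) : bool :=
  [&& [forall h, mate r (mate r h) == h],
      [forall h, ~~ is_stem r h ==> ((mate r h \in out r) == (h \notin out r))],
      [forall h, forall g,
         connect [rel x y | (y == rot r x) || (y == mate r x)] h g]
    & is_bud r (root r)].

(** * Contour, labels and the family R *)

Definition rot_inv (H : finType) (r : bmap H) (h : H) : H := ((rot r)^-1)%g h.

(* From the corner [h], the contour with the face on its right next meets the
   half-edge [rot r h]: it is either crossed (stem) or traversed (edge), and in
   both cases the next corner is [mate r (rot r h)]. *)
Definition contour (H : finType) (r : bmap H) (h : H) : H := mate r (rot r h).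

Definition root_corner (H : finType) (r : bmap H) : H := rot_inv r (root r).

Definition unicellular (H : finType) (r : bmap H) : bool :=
  [forall h, forall g, fconnect (contour r) h g].

Definition contour_index (H : finType) (r : bmap H) (h : H) : nat :=
  findex (contour r) (root_corner r) h.

Definition contour_step (H : finType) (r : bmap H) (h : H) : int :=
  if is_bud r h then 1 else if is_leaf r h then -1 else 0.

Definition label (H : finType) (r : bmap H) (h : H) : int :=
  \sum_(i < contour_index r h)
     contour_step r (rot r (iter i (contour r) (root_corner r))).

(* The contour traverses the edge of [h] away from the vertex of [h] when it
   leaves the corner [rot_inv r h]. *)
Definition well_oriented (H : finType) (r : bmap H) : bool :=
  [forall h, ~~ is_stem r h ==>
     ((h \in out r) ==
      (contour_index r (rot_inv r (mate r h)) < contour_index r (rot_inv r h))%N)].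

(* Looking away from the vertex of [h], the corners on the left and on the
   right of the half-edge [h] are [h] and [rot_inv r h]. *)
Definition well_labeled (H : finType) (r : bmap H) : bool :=
  [forall h, ~~ is_stem r h ==> (label r h == label r (rot_inv r (mate r h)))]
  && [forall h, if h \in out r then label r h == label r (rot_inv r h) + 1
                else label r (rot_inv r h) == label r h + 1].

Definition in_scheme (H : finType) (r : bmap H) (h : H) : bool :=
  (2 < interior_degree r h)%N.

Definition inR (H : finType) (r : bmap H) : bool :=
  [&& rooted_blossoming_map r, unicellular r,
      [forall h, (1 < interior_degree r h)%N],
      [forall h, degree r h == 4],
      well_oriented r, well_labeled r & in_scheme r (root r)].

Definition map_iso (H : finType) (r r' : bmap H) : bool :=
  [exists g : {perm H},
    [&& [forall h, g (rot r h) == rot r' (g h)],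
        [forall h, g (mate r h) == mate r' (g h)],
        [forall h, (g h \in out r') == (h \in out r)]
      & g (root r) == root r']].

(** * Schemes *)

(* Through a vertex of interior degree 2, entered by the half-edge [h]. *)
Definition pass (H : finType) (r : bmap H) (h : H) : H :=
  mate r (odflt h [pick g in porbit (rot r) h | (g != h) && ~~ is_stem r g]).

(* The other end of the edge of the scheme starting with the half-edge [h]:
   the first half-edge at a scheme vertex met along the path starting with [h].
   It is [h] itself when [h] is a stem at a scheme vertex. *)
Definition scheme_mate (H : finType) (r : bmap H) (h : H) : H :=
  head h [seq g <- traject (pass r) (mate r h) #|H| | in_scheme r g].

(* [s] is (a copy of) the unlabeled scheme of [r], where [f] identifies the
   half-edges of [s] with the half-edges of [r] at the scheme vertices. *)
Definition scheme_embedding (S H : finType) (s : bmap S) (r : bmap H)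
    (f : {ffun S -> H}) : bool :=
  [&& injectiveb f,
      [forall h, (h \in codom f) == in_scheme r h],
      [forall x, f (rot s x) == rot r (f x)],
      [forall x, f (mate s x) == scheme_mate r (f x)],
      [forall x, (x \in out s) == (f x \in out r)]
    & f (root s) == root r].

Definition labeled_scheme (S : finType) (s : bmap S) (l : S -> int) : Prop :=
  exists (m : nat) (r : bmap 'I_m) (f : {ffun S -> 'I_m}),
    [/\ inR r, scheme_embedding s r f & forall x, l x = label r (f x)].

Definition unlabeled_scheme (S : finType) (s : bmap S) : Prop :=
  exists l : S -> int, labeled_scheme s l.

Definition vertex (S : finType) (s : bmap S) : finType :=
  {v : {set S} | v \in porbits (rot s)}.

Definition height (S : finType) (s : bmap S) (l : S -> int) (v : vertex s) : int :=
  if [pick x in val v | [forall y in val v, l x <= l y]] is Some x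
  then l x else 0.

Lemma vertexP (S : finType) (s : bmap S) (x : S) :
  porbit (rot s) x \in porbits (rot s).
Proof. exact: imset_f. Qed.

Definition vertex_of (S : finType) (s : bmap S) (x : S) : vertex s :=
  Sub (porbit (rot s) x) (vertexP s x).

Definition relative_label (S : finType) (s : bmap S) (l : S -> int) (x : S) : int :=
  l x - height l (vertex_of s x).

(* [t] is 0 or 1 *)
Definition half_edge_type (S : finType) (s : bmap S) (l : S -> int) (t : int)
    (x : S) : bool :=
  perm_eq [:: relative_label s l (rot_inv s x); relative_label s l x]
          [:: t; t + 1].

Definition offset_toward (S : finType) (s : bmap S) (l : S -> int)
    (u v : vertex s) : Prop :=
  exists x : S, [/\ ~~ is_stem s x, vertex_of s x = u, vertex_of s (mate s x) = v,
    half_edge_type s l 0 x & half_edge_type s l 1 (mate s x)].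

Lemma labeled_scheme_rot (S : finType) (s : bmap S) (l : S -> int) (x : S) :
  labeled_scheme s l ->
  l (rot s x) = l x + (if rot s x \in out s then 1 else -1).
Proof.
case=> m [r [f [rR emb lE]]].
have /and5P[_ _ /forallP rotE _ /andP[/forallP outE _]] := emb.
have /and5P[_ _ _ _ /and3P[_ /andP[_ /forallP wl] _]] := rR.
have := wl (f (rot s x)).
rewrite (eqP (outE _)) !lE (eqP (rotE x)) /rot_inv permK.
by case: ifP => _ /eqP -> //; rewrite addrK.
Qed.

Lemma relative_label_unique (S : finType) (s : bmap S) (l l' : S -> int) :
  labeled_scheme s l -> labeled_scheme s l' ->
  relative_label s l =1 relative_label s l'.
Proof.
move=> hl hl' x; pose c := l x - l' x.
have lE y : y \in porbit (rot s) x -> l y = l' y + c.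
  case/porbitP=> i ->; elim: i => [|i IHi].
    by rewrite expg0 perm1 /c addrC subrK.
  rewrite expgSr permM (labeled_scheme_rot _ hl) (labeled_scheme_rot _ hl') IHi.
  by rewrite addrAC.
rewrite /relative_label /height /=.
set P := fun y => _; set P' := (X in _ = l' x - (if pick X is Some _ then _ else _)).
have eqP' : P =1 P'.
  move=> y; rewrite /P /P' /=; case: (boolP (y \in _)) => //= yx.
  apply: eq_forallb => z; case: (boolP (z \in _)) => //= zx.
  by rewrite (lE _ yx) (lE _ zx) lerD2r.
rewrite (eq_pick eqP'); case: pickP => [y /andP[yx _]|noy].
  by rewrite (lE _ yx) (lE _ (porbit_id _ _)) opprD addrACA subrr addr0.
have [y yx ymin] := @Order.TotalTheory.arg_minP _ _ _ x
  [in porbit (rot s) x] l' (porbit_id _ _).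
have /negP[] := negbT (noy y); rewrite /P' /=.
by apply/andP; split=> //; apply/forallP => z; apply/implyP => /ymin.
Qed.

(* The relative labels do not depend on [l], see [relative_label_unique]. *)
Definition consistent (S : finType) (s : bmap S) (n : nat)
    (nu : vertex s -> 'I_n) : Prop :=
  forall l : S -> int, labeled_scheme s l ->
  forall u v : vertex s, offset_toward l u v -> (nu u < nu v)%N.

(* For a bijection [pi]: [pi] is the height order. *)
Definition height_order (S : finType) (s : bmap S) (l : S -> int) (n : nat)
    (nu : vertex s -> 'I_n) (pi : 'I_n -> vertex s) : bool :=
  [forall i : 'I_n, forall j : 'I_n, (i < j)%N ==>
     ((height l (pi i) < height l (pi j))
      || ((height l (pi i) == height l (pi j)) && (nu (pi i) < nu (pi j))%N))].

(** * Generating series *)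

(* The representatives with [m] half-edges and [k] leaves. *)
Definition Rpi (S : finType) (s : bmap S) (n : nat) (nu : vertex s -> 'I_n)
    (pi : 'I_n -> vertex s) (m k : nat) : {set bmap 'I_m} :=
  [set r | [&& inR r, n_leaves r == k
    & [exists f : {ffun S -> 'I_m}, scheme_embedding s r f
         && height_order (fun x => label r (f x)) nu pi]]].

(* Maps are counted up to isomorphism.  The sum over [m] is a finitely
   supported sum: for given [s] and [k], only finitely many [m] contribute. *)
Definition Rpi_count (S : finType) (s : bmap S) (n : nat) (nu : vertex s -> 'I_n)
    (pi : 'I_n -> vertex s) (k : nat) : nat :=
  \sum_(m \in [set: nat]%classic)
     #|equivalence_partition (@map_iso 'I_m) (Rpi nu pi m k)|.

(* Power series are sequences of coefficients; identities between them are
   stated as identities between truncated polynomials. *)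
Definition Rseries (S : finType) (s : bmap S) (n : nat) (nu : vertex s -> 'I_n)
    (pi : 'I_n -> vertex s) (j : nat) : rat :=
  if j is k.+1 then (Rpi_count nu pi k)%:R else 0.

Definition truncation (a : nat -> rat) (N : nat) : {poly rat} :=
  \poly_(i < N) a i.

Definition Dstep (p : {poly rat}) : {poly rat} :=
  'X * (1 + 4%:R *: p + p ^+ 2).

Definition Dseries (j : nat) : rat := (iter j Dstep 0)`_j.

Lemma Dstep_coef (n : nat) (p q : {poly rat}) :
  (forall i, (i < n)%N -> p`_i = q`_i) ->
  forall i, (i < n.+1)%N -> (Dstep p)`_i = (Dstep q)`_i.
Proof.
move=> pq [|i]; rewrite !coefXM //= ltnS => lti.
rewrite !coefD !coefZ pq //; congr (_ + _); rewrite !expr2 !coefM.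
apply: eq_bigr => j _; rewrite !pq //.
  exact: leq_ltn_trans (leq_subr _ _) lti.
by apply: leq_ltn_trans lti; rewrite -ltnS.
Qed.

Lemma Dseries_coef (n i : nat) : (i <= n)%N -> Dseries i = (iter n Dstep 0)`_i.
Proof.
have step m : forall j, (j < m.+1)%N ->
    (iter m Dstep 0)`_j = (iter m.+1 Dstep 0)`_j.
  elim: m => [|m IHm] j; last by move=> ltj; exact: (Dstep_coef IHm).
  by rewrite ltnS leqn0 => /eqP->; rewrite /= coefXM coef0.
elim: n => [|n IHn]; first by rewrite leqn0 => /eqP->.
rewrite leq_eqVlt => /predU1P[-> // | lei].
by rewrite IHn // step.
Qed.

Lemma DseriesE (N : nat) :
  let D := truncation Dseries N in
  D = take_poly N ('X * (1 + 4%:R *: D + D ^+ 2)).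
Proof.
move=> D; apply/polyP => i; rewrite coef_take_poly coef_poly.
case: ifP => // ltiN; rewrite -/(Dstep D) (@Dseries_coef N.+1 i) ?leqW 1?ltnW //.
apply: (@Dstep_coef N) => [j ltj|]; last exact: leqW.
by rewrite coef_poly ltj (Dseries_coef (ltnW ltj)).
Qed.

(* The series [a] in t is the rational function [F] of [D]: with [F = P / Q],
   this says that Q(D(t)) a(t) = P(D(t)). *)
Definition rational_in_D (a : nat -> rat) (F : {fraction {poly rat}}) : Prop :=
  forall N : nat,
    take_poly N ((\d_(repr F) \Po truncation Dseries N) * truncation a N)
    = take_poly N (\n_(repr F) \Po truncation Dseries N).

Notation "p %:F" := (@FracField.tofrac _ p) : ring_scope.

(* F(y) *)
Definition frac_eval (F y : {fraction {poly rat}}) : {fraction {poly rat}} :=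
  let ev (p : {poly rat}) := (map_poly (fun c : rat => (c%:P)%:F) p).[y] in
  ev \n_(repr F) / ev \d_(repr F).

(* Main.v *)
Require Import Defs.
From HB Require Import structures.
From mathcomp Require Import boolp classical_sets fsbigop.
From mathcomp Require Import all_boot all_order all_fingroup all_algebra.
From mathcomp Require Import generic_quotient fraction.
From mathcomp Require Import zify ring.
Import Defs.

(* A map with scheme s amounts to one word for each edge of s, whose letters
   describe the vertices of interior degree 2 along the edge.  There are six
   letters: four keep the label, one raises it by 1, one lowers it by 1, and each
   vertex carries exactly one leaf.  Hence the words with displacement d have
   generating function D^|d| (1 + 4D + D^2) / (1 - D^2).
   Consistency of the naming makes the sign of the displacement of each edge
   depend only on the height order, so that the sum of the |d| is an affine
   function of the gaps between consecutive heights; the coefficient c_j of the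
   j-th gap is the number of edges crossing it.  A gap is at least 1 at the
   descents of nu o pi and at least 0 elsewhere, and summing the geometric series
   gives, with E edges and L leaves in s,
     t^(L+1) ((1 + 4D + D^2) / (1 - D^2))^E D^e / prod_j (1 - D^c_j)
   where e is the exponent for the smallest gaps.  Reversing the order reverses
   (c_j), exchanges descents and ascents, and changes e into sum_j c_j - e, which
   is also the effect of D -> 1/D up to the sign (-1)^(E + n - 1).  The sign is 1
   by Euler's formula, the scheme being unicellular. *)

Set Implicit Arguments.
Unset Strict Implicit.
Unset Printing Implicit Defensive.

Import Order.TTheory GRing.Theory Num.Theory.
Local Open Scope ring_scope.

(** Membership in R is stated through contour indices, global data that change whenever vertices are
    inserted on edges. What survives is that the contour of the scheme is the first-return map of
    the contour of the full map to the scheme corners: first returns preserve the order of passage,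
    so unicellularity and good orientation transfer in both directions. The series of words comes
    from a recurrence: removing the first letter gives W_d = [d = 0] + t (4 W_d + W_(d-1) +
    W_(d+1)). The equation D = t (1 + 4D + D^2) says precisely that D^|d| solves it for d != 0, and
    the case d = 0 fixes the factor (1 + 4D + D^2) / (1 - D^2). The sign of a displacement is at
    risk only because it is a height difference corrected by a difference of relative labels, which
    can be -1. In that case the edge is offset toward its lower end, and consistency forces a
    descent of the naming between the two ranks, hence a height difference of at least 1. All series
    are handled modulo a power of the variable, which makes words and gaps finite types. *)

Lemma findex_next (T : finType) (F : T -> T) (c h : T) :
  injective F -> fconnect F c h -> F h != c ->
  findex F c (F h) = (findex F c h).+1.
Proof.
move=> injF ch nFh; have lt := findex_max ch.
have e : F h = iter (findex F c h).+1 F c by rewrite /= iter_findex.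
rewrite {1}e findex_iter // ltn_neqAle lt andbT.
by apply: contraNneq nFh => eo; rewrite e eo iter_order.
Qed.

(** Both images are copies of the quotient of [D] by the same equivalence relation. This later
    matches isomorphism classes of maps with families of words. *)
Lemma card_imset_ker (T A B : finType) (D : {set T}) (F : T -> A) (G : T -> B) :
  {in D &, forall x y, (F x == F y) = (G x == G y)} -> #|F @: D| = #|G @: D|.
Proof.
move=> FG.
have [D0|[d0 d0D]] := set_0Vmem D; first by rewrite D0 !imset0 !cards0.
pose c a := odflt d0 [pick x in D | F x == a].
have cP x : x \in D -> (c (F x) \in D) && (F (c (F x)) == F x).
  by move=> xD; rewrite /c; case: pickP => [//|/(_ x)]; rewrite xD eqxx.
rewrite -(card_in_imset (f := fun a => G (c a))).
  apply: eq_card => b; apply/imsetP/imsetP.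
    move=> [_ /imsetP[x xD ->] ->].
    by have /andP[cD _] := cP _ xD; exists (c (F x)).
  move=> [x xD ->]; exists (F x); first exact: imset_f.
  by have /andP[cD] := cP _ xD; rewrite FG // => /eqP.
move=> _ _ /imsetP[x xD ->] /imsetP[y yD ->] /eqP.
have /andP[cxD /eqP cx] := cP _ xD; have /andP[cyD /eqP cy] := cP _ yD.
by rewrite -FG // cx cy => /eqP.
Qed.

(** * First returns *)

Section FirstReturn.
Variables (S H : finType) (F : H -> H) (G : S -> S) (f : S -> H).
Hypotheses (injF : injective F) (injf : injective f).

(* [h] lies on the [F]-trajectory of [f z], before its first return to the image
   of [f]. *)
Definition reach (z : S) (h : H) : Prop :=
  exists2 n, h = iter n F (f z) &
    forall i, (0 < i <= n)%N -> iter i F (f z) \notin codom f.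

Lemma reach0 z : reach z (f z).
Proof. by exists 0%N => // i; case: i. Qed.

Lemma reachS z h : reach z h -> F h \notin codom f -> reach z (F h).
Proof.
move=> [n -> hn] nF; exists n.+1 => // i /andP[i0].
rewrite leq_eqVlt => /predU1P[-> //|lti].
by apply: hn; rewrite i0.
Qed.

Hypothesis ret : forall z, exists2 h, reach z h & F h = f (G z).
Hypothesis cov : forall h, exists z, reach z h.

Lemma return_time z : exists k, iter k.+1 F (f z) = f (G z) /\
  forall i, (0 < i <= k)%N -> iter i F (f z) \notin codom f.
Proof. by have [h [k -> hk] e] := ret z; exists k. Qed.

Lemma reach_fconnect z h : reach z h -> fconnect F (f z) h.
Proof. by move=> [n -> _]; exact: fconnect_iter. Qed.

Lemma first_return_up :
  (forall z z', fconnect G z z') -> forall h h', fconnect F h h'.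
Proof.
have up z n : fconnect F (f z) (f (iter n G z)).
  elim: n => [|n IHn] //=; apply: connect_trans IHn _.
  by have [k [<- _]] := return_time (iter n G z); exact: fconnect_iter.
move=> uniG h h'; have [z /reach_fconnect zh] := cov h.
have [z' /reach_fconnect zh'] := cov h'.
rewrite fconnect_sym // in zh; apply: connect_trans zh (connect_trans _ zh').
by have /iter_findex <- := uniG z z'; exact: up.
Qed.

(** Strong induction on the number of [F]-steps from [f z] to [f z']: the first return to the image
    of [f] occurs no later than the target, and what remains is a shorter trajectory from
    [f (G z)]. *)
Lemma first_return_down :
  (forall h h', fconnect F h h') -> forall z z', fconnect G z z'.
Proof.
move=> uniF z z'; have /iter_findex := uniF (f z) (f z').
move: (findex _ _ _) => n; elim/ltn_ind: n z => n IHn z e.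
case: n => [|n] in IHn e *; first by rewrite (injf e).
have [k [ek hk]] := return_time z.
have kn : (k <= n)%N.
  rewrite leqNgt; apply/negP => nk; have := hk n.+1.
  by rewrite nk e codom_f => /(_ isT).
apply: connect_trans (fconnect1 _ _) (IHn (n - k)%N _ _ _).
  by rewrite ltnS leq_subr.
by rewrite -ek -iterD addnS subnK.
Qed.

Section Order.
Hypothesis uniF : forall h h', fconnect F h h'.
Variable c : S.
Let idx h := findex F (f c) h.

Lemma idx_segment z n :
  (forall i, (0 < i <= n)%N -> iter i F (f z) != f c) ->
  idx (iter n F (f z)) = (idx (f z) + n)%N.
Proof.
elim: n => [|n IHn] hn; first by rewrite addn0.
rewrite iterS /idx findex_next //.
  by rewrite -/(idx _) IHn ?addnS // => i /andP[i0 lei]; rewrite hn // i0 leqW.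
by apply: (hn n.+1); rewrite ltnSn.
Qed.

Lemma reach_lt_return z h :
  reach z h -> G z != c -> (idx h < idx (f (G z)))%N.
Proof.
move=> [n -> hn] Gz; have [k [ek hk]] := return_time z.
have nk : (n <= k)%N.
  rewrite leqNgt; apply/negP => kn; have := hn k.+1.
  by rewrite kn ek codom_f => /(_ isT).
have nc i : (0 < i <= k.+1)%N -> iter i F (f z) != f c.
  move=> /andP[i0]; rewrite leq_eqVlt => /predU1P[->|lti].
    by rewrite ek (inj_eq injf).
  by apply: contraNneq (hk i _) => [->|]; rewrite ?codom_f ?i0.
rewrite -ek !idx_segment // ?ltn_add2l // => i /andP[i0 lei].
by apply: nc; rewrite i0 (leq_trans lei) // leqW.
Qed.

Lemma reach_ge z h : reach z h -> (idx (f z) <= idx h)%N.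
Proof.
move=> [n -> hn]; rewrite idx_segment ?leq_addr // => i hi.
by apply: contraNneq (hn i hi) => ->; exact: codom_f.
Qed.

(** Up to the return to [c], the indices of the points [f (iter n G c)] increase with [n], and
    whatever is reached from [z] comes before the next such point. The index cannot wrap around in
    between, since [f c] itself lies in the image of [f]. *)
Lemma first_return_index z z' h h' : reach z h -> reach z' h' ->
  (findex G c z < findex G c z')%N -> (idx h < idx h')%N.
Proof.
move=> zh zh' lt; apply: leq_trans (reach_ge zh').
have cz' : fconnect G c z' by apply: first_return_down.
have cz : fconnect G c z by apply: first_return_down.
have ltm := findex_max cz'.
have step n : (n.+1 < fingraph.order G c)%N -> G (iter n G c) != c.
  move=> ltn; apply: contraTneq (isT) => e.
  have := findex_iter ltn; rewrite /= e findex0 => //.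
have mono n m : (n <= m)%N -> (m < fingraph.order G c)%N ->
    (idx (f (iter n G c)) <= idx (f (iter m G c)))%N.
  elim: m => [|m IHm]; first by rewrite leqn0 => /eqP->.
  rewrite leq_eqVlt => /predU1P[-> //|len] ltm'.
  apply: leq_trans (IHm len (ltnW ltm')) (ltnW _).
  by apply: reach_lt_return (reach0 _) _; apply: step.
have Gz : G z != c.
  by rewrite -{1}(iter_findex cz) step // (leq_ltn_trans lt).
apply: leq_trans (reach_lt_return zh Gz) _.
rewrite -{1}(iter_findex cz) -{1}(iter_findex cz') -iterS.
exact: mono.
Qed.

Lemma first_return_indexE z z' h h' : z != z' -> reach z h -> reach z' h' ->
  (idx h < idx h')%N = (findex G c z < findex G c z')%N.
Proof.
move=> zz' zh zh'; have [lt|] := ltnP (findex G c z) _.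
  exact: first_return_index lt.
rewrite leq_eqVlt => /predU1P[e|lt].
  case/eqP: zz'.
  rewrite -(iter_findex (first_return_down uniF c z)) -e.
  exact: iter_findex (first_return_down uniF c z').
by apply/negbTE; rewrite -leqNgt ltnW // (first_return_index zh' zh lt).
Qed.

End Order.
End FirstReturn.

(** * Maps of degree 4 *)

Section Bmap.
Variables (H : finType) (r : bmap H).
Implicit Types h g : H.

Lemma rot_invK : cancel (rot_inv r) (rot r).
Proof. exact: permKV. Qed.

Lemma rotK : cancel (rot r) (rot_inv r).
Proof. exact: permK. Qed.

Lemma contour_inj : injective (contour r).
Proof. by move=> h g /perm_inj/perm_inj. Qed.

(** [label] sums the contour steps from the root corner, so every function that starts at 0 and
    follows these steps agrees with it. Labels can thus be identified without computing any contour
    index. *)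
Lemma label_unique (l : H -> int) : unicellular r -> l (root_corner r) = 0 ->
  (forall h, l (contour r h) = l h + contour_step r (rot r h)) ->
  label r =1 l.
Proof.
move=> /forallP/(_ (root_corner r))/forallP uni l0 lS h.
have ln n : l (iter n (contour r) (root_corner r)) =
    \sum_(i < n) contour_step r (rot r (iter i (contour r) (root_corner r))).
  elim: n => [|n IHn]; first by rewrite big_ord0.
  by rewrite big_ord_recr /= lS IHn.
by rewrite /label -ln iter_findex.
Qed.

Lemma label_root_corner : label r (root_corner r) = 0.
Proof. by rewrite /label /contour_index findex0 big_ord0. Qed.

Lemma unicellular_ind (P : H -> Prop) h0 : unicellular r -> P h0 ->
  (forall h, P h -> P (contour r h)) -> forall h, P h.
Proof.
move=> /forallP/(_ h0)/forallP uni P0 PS h.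
have /iter_findex <- := uni h; elim: (findex _ _ _) => [//|n IHn] /=.
exact: PS.
Qed.

Section Degree4.
Hypothesis deg4 : forall h, degree r h = 4.

Lemma porbit_traject4 h : porbit (rot r) h =i traject (rot r) h 4.
Proof. by move=> g; rewrite porbit_traject -/(degree r h) deg4. Qed.

Lemma rot4_uniq h : uniq (traject (rot r) h 4).
Proof. by have := uniq_traject_porbit (rot r) h; rewrite -/(degree r h) deg4. Qed.

Lemma rot4 h : rot r (rot r (rot r (rot r h))) = h.
Proof. by have := iter_porbit (rot r) h; rewrite -/(degree r h) deg4. Qed.

Lemma rot_iter_inj h i j : (i < 4)%N -> (j < 4)%N ->
  iter i (rot r) h = iter j (rot r) h -> i = j.
Proof.
move=> lti ltj e; apply/eqP.
rewrite -(nth_uniq h _ _ (rot4_uniq h)) ?size_traject //.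
by rewrite !nth_traject // e.
Qed.

Lemma interior_degree4 h : interior_degree r h =
  (~~ is_stem r h + (~~ is_stem r (rot r h) + (~~ is_stem r (rot r (rot r h))
   + ~~ is_stem r (rot r (rot r (rot r h))))))%N.
Proof.
transitivity (count (predC (is_stem r)) (traject (rot r) h 4)); last first.
  by rewrite /= addn0.
rewrite -size_filter -(card_uniqP (filter_uniq _ (rot4_uniq h))).
by apply: eq_card => g; rewrite inE mem_filter porbit_traject4 andbC.
Qed.

Lemma interior_degree_rot h : interior_degree r (rot r h) = interior_degree r h.
Proof.
by rewrite !interior_degree4 rot4; do 4!case: (is_stem r _).
Qed.

Lemma in_scheme_rot h : in_scheme r (rot r h) = in_scheme r h.
Proof. by rewrite /in_scheme interior_degree_rot. Qed.

Lemma in_scheme_iter h i : in_scheme r (iter i (rot r) h) = in_scheme r h.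
Proof. by elim: i => //= i IHi; rewrite in_scheme_rot. Qed.

Lemma in_scheme_rot_inv h : in_scheme r (rot_inv r h) = in_scheme r h.
Proof. by rewrite -{2}(rot_invK h) in_scheme_rot. Qed.

End Degree4.

Lemma pass_unique h g : interior_degree r h = 2 -> g \in porbit (rot r) h ->
  g != h -> ~~ is_stem r h -> ~~ is_stem r g -> pass r h = mate r g.
Proof.
move=> id2 gh ne nh ng; rewrite /pass; case: pickP => [k|]; last first.
  by move/(_ g); rewrite gh ne ng.
move=> /and3P[kh nek nk] /=; congr (mate r _); apply/eqP/negP => /negP kg.
have : (2 < interior_degree r h)%N; last by rewrite id2.
rewrite /interior_degree -[3%N]/(size [:: h; g; k]).
have u : uniq [:: h; g; k] by rewrite /= !inE negb_or eq_sym ne eq_sym nek eq_sym kg.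
rewrite -(card_uniqP u); apply: subset_leq_card; apply/subsetP => x.
rewrite !inE => /or3P[] /eqP->; rewrite ?nh ?ng ?nk ?gh ?kh ?porbit_id //.
Qed.

Lemma scheme_mateP h K :
  (forall i, (i < K)%N -> ~~ in_scheme r (iter i (pass r) (mate r h))) ->
  in_scheme r (iter K (pass r) (mate r h)) ->
  scheme_mate r h = iter K (pass r) (mate r h).
Proof.
set P := pass r; set h0 := mate r h => hlt hK.
(* [scheme_mate] inspects only [#|H|] points. The target is first met at a time below the size of
   its orbit, and by [hlt] this time is not smaller than [K]. *)
have KH : (K < #|H|)%N.
  have c : fconnect P h0 (iter K P h0) by exact: fconnect_iter.
  have ltf := findex_max c; have e := iter_findex c.
  apply: leq_ltn_trans (leq_trans ltf (max_card _)).
  by rewrite leqNgt; apply/negP => /hlt; rewrite e hK.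
rewrite /scheme_mate -/h0 -/P -(subnKC KH) trajectD filter_cat trajectSr.
rewrite filter_rcons hK; suff -> : [seq g <- traject P h0 K | in_scheme r g] = [::] by [].
apply/eqP; rewrite -[_ == _]negbK -has_filter; apply/hasPn => g /trajectP[i lti ->].
exact: hlt.
Qed.

End Bmap.

(** * Expansions of a scheme *)

(* A vertex of interior degree 2 entered by the half-edge 0 is left by the
   half-edge [lv a] (counterclockwise from 0); its two stems have opposite
   orientations and [a.2] tells whether the first one is a bud. *)
Notation letter := ('I_3 * bool)%type.
Definition lv (a : letter) : nat := a.1.+1.
(** Labels shift only when the exit is opposite to the entrance, with one stem on each side of the
    path. Two stems on the same side are a bud and a leaf, whose effects cancel. *)
Definition disp (a : letter) : int :=
  if a.1 == 1 :> nat then (if a.2 then 1 else -1) else 0.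
Definition wdisp (u : seq letter) : int := \sum_(a <- u) disp a.
Definition letter0 : letter := (ord0, true).
(** Half-edge 0 comes in and half-edge [lv a] goes out. The first stem is half-edge 1, unless that
    one is the exit, in which case it is half-edge 2. *)
Definition letter_out (a : letter) (j : nat) : bool :=
  if j == 0%N then false else if j == lv a then true
  else if j == (if lv a == 1%N then 2 else 1)%N then a.2 else ~~ a.2.
Definition updown (b : bool) : int := if b then 1 else -1.
(** Labels of the corners of an inserted vertex, normalised to 0 at the corner on the right of the
    entering edge, seen along its orientation. Corner 3, on the left of that edge, must then have
    label 1. *)
Fixpoint letter_label (a : letter) (j : nat) : int :=
  if j is k.+1 then letter_label a k + updown (letter_out a j) else 0.

Lemma letter_label3 a : letter_label a 3 = 1.
Proof. by case: a => [[[|[|[|i]]] lti] []]. Qed.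

Lemma letter_label_lv a : letter_label a (lv a) = disp a + 1.
Proof. by case: a => [[[|[|[|i]]] lti] []]. Qed.

Lemma lv_bounds a : (0 < lv a < 4)%N.
Proof. by case: a => i b; rewrite /lv /= ltnS ltn_ord. Qed.

Definition edges (S : finType) (s : bmap S) : {set S} :=
  [set x | ~~ is_stem s x & x \in out s].

Lemma card_porbit4 (T : finType) (p : {perm T}) h :
  uniq (traject p h 4) -> iter 4 p h = h -> #|porbit p h| = 4.
Proof.
move=> u c; rewrite -[RHS]/(size (traject p h 4)) -(card_uniqP u).
apply: eq_card => g; apply/porbitP/idP => [[i ->]|].
  elim: i => [|i]; first by rewrite expg0 perm1 inE eqxx.
  rewrite expgSr permM !inE => /or4P[]/eqP->; rewrite ?eqxx ?orbT //.
  by move: c => /= ->; rewrite eqxx.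
by case/trajectP=> i _ ->; exists i; rewrite permX.
Qed.

Section Expansion.
Variables (S : finType) (s : bmap S) (w : S -> seq letter).

(* [inl x] is a half-edge of the scheme; [inr (x, i, j)] is the [j]-th half-edge
   of the [i]-th vertex inserted on the edge starting with [x]. *)
Definition raw := (S + S * nat * nat)%type.

Implicit Types (x y z : S) (p q : raw) (i j : nat).

Definition lvl x i := lv (nth letter0 (w x) i).
(** The inserted vertices cut the edge starting with [x] into [size (w x) + 1] segments; the [i]-th
    one is oriented from [bwd x i] to [fwd x i]. The extreme cases of the two definitions are the
    half-edges of the scheme. *)
Definition fwd x i : raw :=
  if (i < size (w x))%N then inr (x, i, 0%N) else inl (mate s x).
Definition bwd x i : raw := if i is k.+1 then inr (x, k, lvl x k) else inl x.

Definition rawrot p : raw := match p with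
  | inl x => inl (rot s x)
  | inr (x, i, j) => inr (x, i, if j is 3 then 0%N else j.+1) end.
Definition rawmate p : raw := match p with
  | inl x => if is_stem s x then p else if x \in out s then fwd x 0
             else bwd (mate s x) (size (w (mate s x)))
  | inr (x, i, j) => if j == 0%N then bwd x i
                     else if j == lvl x i then fwd x i.+1 else p end.
Definition rawout p : bool := match p with
  | inl x => x \in out s
  | inr (x, i, j) => letter_out (nth letter0 (w x) i) j end.
(** The type [raw] is infinite and does not depend on [w]; this predicate selects the half-edges
    that really occur for [w]. *)
Definition valid p : bool := match p with
  | inl x => true
  | inr (x, i, j) => [&& x \in edges s, (i < size (w x))%N & (j < 4)%N] end.

(** A relation rather than a construction: the same notion then applies to maps built from words and
    to arbitrary maps analysed into words. *)
Record expansion (H : finType) (r : bmap H) (e : raw -> H) : Prop := Expansion {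
  exp_inj : {in valid &, injective e};
  exp_surj : forall h, exists2 p, valid p & e p = h;
  exp_rot : forall p, valid p -> rot r (e p) = e (rawrot p);
  exp_mate : forall p, valid p -> mate r (e p) = e (rawmate p);
  exp_out : forall p, valid p -> (e p \in out r) = rawout p;
  exp_root : root r = e (inl (root s)) }.

Hypothesis mateK : forall x, mate s (mate s x) = x.
Hypothesis mate_out :
  forall x, ~~ is_stem s x -> (mate s x \in out s) = (x \notin out s).
Hypothesis deg4 : forall x, degree s x = 4.

Lemma is_stem_mate x : is_stem s (mate s x) = is_stem s x.
Proof. by rewrite /is_stem mateK eq_sym. Qed.

Lemma edges_mate x : ~~ is_stem s x -> x \notin out s -> mate s x \in edges s.
Proof. by move=> nx ox; rewrite inE is_stem_mate nx mate_out. Qed.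

Lemma edges_stem x : x \in edges s -> is_stem s x = false.
Proof. by rewrite inE => /andP[/negbTE]. Qed.

Lemma edges_out x : x \in edges s -> x \in out s.
Proof. by rewrite inE => /andP[]. Qed.

Lemma edges_mate_out x : x \in edges s -> (mate s x \in out s) = false.
Proof. by rewrite inE => /andP[nx ox]; rewrite mate_out // ox. Qed.

Lemma lvl_bounds x i : (0 < lvl x i < 4)%N.
Proof. exact: lv_bounds. Qed.

Lemma valid_rot p : valid p -> valid (rawrot p).
Proof.
by case: p => [//|[[x i] j]] /= /and3P[-> -> ltj]; case: j ltj => [|[|[|[|j]]]].
Qed.

Lemma valid_fwd x i : x \in edges s -> valid (fwd x i).
Proof. by rewrite /fwd; case: ifP => //= -> ->. Qed.

Lemma valid_bwd x i : x \in edges s -> (i <= size (w x))%N -> valid (bwd x i).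
Proof.
by case: i => //= i -> ->; have /andP[_ ->] := lvl_bounds x i.
Qed.

Lemma rawmate_fwd x i : x \in edges s -> (i <= size (w x))%N ->
  rawmate (fwd x i) = bwd x i.
Proof.
move=> xE; rewrite /fwd leq_eqVlt; case: ltnP => //= _; rewrite orbF => /eqP->.
by rewrite is_stem_mate (edges_stem xE) (edges_mate_out xE) mateK.
Qed.

Lemma rawmate_bwd x i : x \in edges s -> rawmate (bwd x i) = fwd x i.
Proof.
move=> xE; case: i => [|i] /=; first by rewrite (edges_stem xE) (edges_out xE).
by rewrite eqxx.
Qed.

Lemma rawout_fwd x i : x \in edges s -> rawout (fwd x i) = false.
Proof. by move=> xE; rewrite /fwd; case: ifP => //= _; exact: edges_mate_out. Qed.

Lemma rawout_bwd x i : x \in edges s -> rawout (bwd x i) = true.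
Proof.
case: i => [|i] xE /=; first exact: edges_out.
by rewrite /letter_out eqxx; have /andP[/lt0n_neq0/negbTE-> _] := lvl_bounds x i.
Qed.

Lemma fwd_neq_bwd x i : x \in edges s -> fwd x i != bwd x i.
Proof.
by move=> xE; apply: contraTneq isT => e; have := rawout_fwd i xE; rewrite e rawout_bwd.
Qed.

(** The case analysis behind most proofs below: a half-edge is the head of a segment, the tail of a
    segment, or a stem. *)
Variant raw_spec p : Prop :=
  | RawFwd x i of x \in edges s & (i <= size (w x))%N & p = fwd x i
  | RawBwd x i of x \in edges s & (i <= size (w x))%N & p = bwd x i
  | RawStem of rawmate p = p.

Lemma rawP p : valid p -> raw_spec p.
Proof.
case: p => [x _|[[x i] j] /and3P[xE lti ltj]].
  have [sx|nx] := boolP (is_stem s x); first by apply: RawStem; rewrite /= sx.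
  have [ox|ox] := boolP (x \in out s).
    by apply: (@RawBwd _ x 0%N); rewrite // inE nx.
  have mE := edges_mate nx ox.
  by apply: (RawFwd mE (leqnn _)); rewrite /fwd ltnn mateK.
have [j0|j0] := eqVneq j 0%N.
  by apply: (@RawFwd _ x i); rewrite ?(ltnW lti) // /fwd lti j0.
have [jl|jl] := eqVneq j (lvl x i); first by apply: (@RawBwd _ x i.+1); rewrite ?jl.
by apply: RawStem; rewrite /= (negbTE j0) (negbTE jl).
Qed.

Lemma valid_mate p : valid p -> valid (rawmate p).
Proof.
move=> vp; have [x i xE lei ->|x i xE lei ->|-> //] := rawP vp.
  by rewrite rawmate_fwd // valid_bwd.
by rewrite rawmate_bwd // valid_fwd.
Qed.

Lemma rawmateK p : valid p -> rawmate (rawmate p) = p.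
Proof.
move=> vp; have [x i xE lei ->|x i xE lei ->|e] := rawP vp.
- by rewrite rawmate_fwd // rawmate_bwd.
- by rewrite rawmate_bwd // rawmate_fwd.
by rewrite !e.
Qed.

Lemma rawout_mate p : valid p -> rawmate p != p -> rawout (rawmate p) = ~~ rawout p.
Proof.
move=> vp; have [x i xE lei ->|x i xE lei ->|->] := rawP vp; last by rewrite eqxx.
  by rewrite rawmate_fwd // rawout_fwd // rawout_bwd.
by rewrite rawmate_bwd // rawout_fwd // rawout_bwd.
Qed.

Lemma rawrot4 p : valid p -> iter 4 rawrot p = p.
Proof.
case: p => [x _|[[x i] j] /and3P[_ _]] /=; first by rewrite rot4.
by case: j => [|[|[|[|]]]].
Qed.

Lemma rawrot_inj : {in valid &, injective rawrot}.
Proof.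
by move=> p q vp vq e; rewrite -(rawrot4 vp) -(rawrot4 vq) !iterSr e.
Qed.

Lemma rawrot_uniq p : valid p -> uniq (traject rawrot p 4).
Proof.
case: p => [x _|[[x i] j] /and3P[_ _]].
  have -> : traject rawrot (inl x) 4 = map inl (traject (rot s) x 4) by [].
  by rewrite map_inj_uniq ?rot4_uniq // => ? ? [].
pose g k : raw := inr (x, i, k); have gi : injective g by move=> ? ? [].
case: j => [|[|[|[|]]]] //= _.
- by rewrite -[X in is_true X]/(uniq (map g [:: 0; 1; 2; 3]%N)) map_inj_uniq.
- by rewrite -[X in is_true X]/(uniq (map g [:: 1; 2; 3; 0]%N)) map_inj_uniq.
- by rewrite -[X in is_true X]/(uniq (map g [:: 2; 3; 0; 1]%N)) map_inj_uniq.
- by rewrite -[X in is_true X]/(uniq (map g [:: 3; 0; 1; 2]%N)) map_inj_uniq.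
Qed.

Lemma rawmate_inl x : (rawmate (inl x) == inl x) = is_stem s x.
Proof.
rewrite /=; have [sx|nx] := boolP (is_stem s x); first exact: eqxx.
apply/negbTE; apply: contra nx; rewrite /bwd /fwd.
case: ifP => _; first by case: ifP => // _ /eqP[e]; rewrite /is_stem e.
by case: (size _) => // /eqP[e]; rewrite /is_stem e.
Qed.

Lemma rawmate_inr x i j : (j < 4)%N ->
  (rawmate (inr (x, i, j)) == inr (x, i, j)) = (j != 0%N) && (j != lvl x i).
Proof.
move=> ltj /=; have [->|j0] := eqVneq j 0%N.
  by apply/negbTE; case: i => //= i; apply/eqP => -[]; lia.
have [->|_] /= := eqVneq j (lvl x i); last exact: eqxx.
by apply/negbTE; rewrite /fwd; case: ifP => // _; apply/eqP => -[]; lia.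
Qed.

Section Realization.
Variables (H : finType) (r : bmap H) (e : raw -> H).
Hypothesis E : expansion r e.

Let f x := e (inl x).

Lemma exp_inl_inj : injective f.
Proof. by move=> x y /(exp_inj E)-/(_ isT isT)[]. Qed.

Lemma exp_eq p q : valid p -> valid q -> (e p == e q) = (p == q).
Proof. by move=> vp vq; apply/eqP/eqP => [/(exp_inj E)->|->]. Qed.

Lemma exp_stem p : valid p -> is_stem r (e p) = (rawmate p == p).
Proof. by move=> vp; rewrite /is_stem exp_mate // exp_eq // valid_mate. Qed.

Lemma exp_stem_inl x : is_stem r (f x) = is_stem s x.
Proof. by rewrite exp_stem // rawmate_inl. Qed.

Lemma exp_iter_rot p n : valid p ->
  valid (iter n rawrot p) /\ iter n (rot r) (e p) = e (iter n rawrot p).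
Proof.
move=> vp; elim: n => [//|n [vn IHn]] /=.
by rewrite IHn exp_rot // valid_rot.
Qed.

Lemma exp_degree h : degree r h = 4.
Proof.
have [p vp <-] := exp_surj E h; apply: card_porbit4; last first.
  by have [_ ->] := exp_iter_rot 4 vp; rewrite rawrot4.
have v0 := valid_rot vp; have v1 := valid_rot v0; have v2 := valid_rot v1.
have := rawrot_uniq vp; rewrite /= !exp_rot // !inE !exp_eq //.
Qed.

Lemma exp_mateK h : mate r (mate r h) = h.
Proof.
have [p vp <-] := exp_surj E h.
by rewrite !(exp_mate E) ?valid_mate // rawmateK.
Qed.

Lemma exp_mate_out h : ~~ is_stem r h -> (mate r h \in out r) = (h \notin out r).
Proof.
have [p vp <-] := exp_surj E h; rewrite exp_stem // => np.
by rewrite exp_mate // !(exp_out E) ?valid_mate // rawout_mate.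
Qed.

Lemma exp_interior_inl x : interior_degree r (f x) = interior_degree s x.
Proof.
rewrite !interior_degree4 //; last exact: exp_degree.
by rewrite /f !(exp_rot E) //= -/(f _) !exp_stem_inl.
Qed.

Lemma exp_interior_inr x i j : valid (inr (x, i, j)) ->
  interior_degree r (e (inr (x, i, j))) = 2.
Proof.
move=> vp; have /and3P[xE lti ltj] := vp.
have v k : (k < 4)%N -> valid (inr (x, i, k)) by rewrite /= xE lti.
suff h0 : interior_degree r (e (inr (x, i, 0%N))) = 2.
  have ej : iter j rawrot (inr (x, i, 0%N)) = inr (x, i, j).
    by clear -ltj; case: j ltj => [|[|[|[|]]]].
  rewrite -ej; have [_ <-] := exp_iter_rot j (v 0%N isT); rewrite -h0.
  by elim: j {vp ltj ej} => //= j <-; exact: (interior_degree_rot exp_degree).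
rewrite (interior_degree4 exp_degree) !(exp_rot E) ?v //=.
rewrite !(exp_stem) ?v // !rawmate_inr // /lvl.
by case: (nth _ _ _) => [[[|[|[|k]]] lt] b].
Qed.

Hypothesis in_scheme_s : forall x, in_scheme s x.

Lemma exp_in_scheme_inl x : in_scheme r (f x).
Proof. by rewrite /in_scheme exp_interior_inl; exact: in_scheme_s. Qed.

Lemma exp_in_scheme p : valid p -> in_scheme r (e p) = if p is inl _ then true else false.
Proof.
case: p => [x|[[x i] j]] vp; first exact: exp_in_scheme_inl.
by rewrite /in_scheme exp_interior_inr.
Qed.

Lemma exp_codom p : valid p -> (e p \in codom f) = if p is inl _ then true else false.
Proof.
case: p => [x _|[[x i] j] vp]; first exact: codom_f.
by apply/codomP => -[x' /(exp_inj E)-/(_ vp isT)].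
Qed.

Lemma exp_rot_inv_inl x : rot_inv r (f x) = f (rot_inv s x).
Proof. by apply: (@perm_inj _ (rot r)); rewrite rot_invK (exp_rot E) //= rot_invK. Qed.

Lemma exp_rot_inv_inr x i j : valid (inr (x, i, j.+1)) ->
  rot_inv r (e (inr (x, i, j.+1))) = e (inr (x, i, j)).
Proof.
move=> /and3P[xE lti ltj]; apply: (@perm_inj _ (rot r)).
rewrite rot_invK (exp_rot E) /= ?xE ?lti ?(ltnW ltj) //.
by case: j ltj => [|[|[|]]].
Qed.

Lemma exp_rot_inv_inr0 x i : valid (inr (x, i, 0%N)) ->
  rot_inv r (e (inr (x, i, 0%N))) = e (inr (x, i, 3)).
Proof.
move=> /and3P[xE lti ltj]; apply: (@perm_inj _ (rot r)).
by rewrite rot_invK (exp_rot E) /= ?xE ?lti.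
Qed.

Lemma exp_contour_bwd x i : x \in edges s -> (i <= size (w x))%N ->
  contour r (rot_inv r (e (bwd x i))) = e (fwd x i).
Proof.
by move=> xE lei; rewrite /contour rot_invK exp_mate ?valid_bwd ?rawmate_bwd.
Qed.

Lemma exp_contour_fwd x i : x \in edges s -> (i <= size (w x))%N ->
  contour r (rot_inv r (e (fwd x i))) = e (bwd x i).
Proof.
by move=> xE lei; rewrite /contour rot_invK exp_mate ?valid_fwd ?rawmate_fwd.
Qed.

Lemma exp_contour_stem x i j : valid (inr (x, i, j.+1)) -> j.+1 != lvl x i ->
  contour r (e (inr (x, i, j))) = e (inr (x, i, j.+1)).
Proof.
move=> vp nl; rewrite -exp_rot_inv_inr // /contour rot_invK exp_mate //=.
by rewrite (negbTE nl).
Qed.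

Notation reachr := (reach (contour r) f).

(** Following the orientation, the contour runs along the right side of the path. At each inserted
    vertex it meets the corners before the exit, [j < lvl x i], crossing the stems between them;
    none of them is a scheme corner, so no return has occurred yet. *)
Lemma reach_fwd x i : x \in edges s -> (i <= size (w x))%N ->
  reachr (rot_inv s x) (rot_inv r (e (bwd x i))) /\
  (forall j, (i < size (w x))%N -> (j < lvl x i)%N ->
   reachr (rot_inv s x) (e (inr (x, i, j)))).
Proof.
move=> xE; elim: i => [|i IHi] lei.
  have h0 : reachr (rot_inv s x) (rot_inv r (e (bwd x 0))).
    by rewrite /= -/(f x) exp_rot_inv_inl; exact: reach0.
  split=> //; elim=> [|j IHj] lti ltj.
    move: (exp_contour_bwd xE (leq0n _)); rewrite /fwd lti => <-.
    by apply: reachS => //; rewrite exp_contour_bwd // /fwd lti exp_codom //= xE lti.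
  have lt4 : (j.+1 < 4)%N by have := lvl_bounds x 0; lia.
  have v : valid (inr (x, 0%N, j.+1)) by rewrite /= xE lti.
  rewrite -exp_contour_stem //; last by rewrite neq_ltn ltj.
  apply: reachS; first by apply: IHj => //; exact: ltnW.
  by rewrite exp_contour_stem ?exp_codom // neq_ltn ltj.
have [_ IH] := IHi (ltnW lei).
have h0 : reachr (rot_inv s x) (rot_inv r (e (bwd x i.+1))).
  have [k ek] : exists k, lvl x i = k.+1 by exists (nth letter0 (w x) i).1.
  have /andP[_ l4] := lvl_bounds x i; rewrite ek in l4.
  rewrite /bwd ek exp_rot_inv_inr /= ?xE ?lei //.
  by apply: IH; rewrite ?ek.
split=> //; elim=> [|j IHj] lti ltj.
  move: (exp_contour_bwd xE lei); rewrite /fwd lti => <-.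
  by apply: reachS => //; rewrite exp_contour_bwd // /fwd lti exp_codom //= xE lti.
have lt4 : (j.+1 < 4)%N by have := lvl_bounds x i.+1; lia.
have v : valid (inr (x, i.+1, j.+1)) by rewrite /= xE lti.
rewrite -exp_contour_stem //; last by rewrite neq_ltn ltj.
apply: reachS; first by apply: IHj => //; exact: ltnW.
by rewrite exp_contour_stem ?exp_codom // neq_ltn ltj.
Qed.

(** The traversal against the orientation meets the remaining corners, those with
    [lvl x i <= j < 4]. It starts at the far end, so the induction is on the number [k] of vertices
    counted from there. *)
Lemma reach_bwd x k : x \in edges s -> (k <= size (w x))%N ->
  let i := (size (w x) - k)%N in
  reachr (rot_inv s (mate s x)) (rot_inv r (e (fwd x i))) /\
  (forall j, (i < size (w x))%N -> (lvl x i <= j < 4)%N ->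
   reachr (rot_inv s (mate s x)) (e (inr (x, i, j)))).
Proof.
move=> xE; elim: k => [|k IHk] lek i.
  have ei : i = size (w x) by rewrite /i subn0.
  split; last by rewrite ei ltnn.
  by rewrite ei /fwd ltnn -/(f _) exp_rot_inv_inl; exact: reach0.
have lti : (i < size (w x))%N by rewrite /i; lia.
have [IH _] := IHk (ltnW lek).
have eS : (size (w x) - k)%N = i.+1 by rewrite /i; lia.
rewrite eS in IH.
have h j : (lvl x i <= j < 4)%N -> reachr (rot_inv s (mate s x)) (e (inr (x, i, j))).
  elim: j => [|j IHj]; first by have := lvl_bounds x i; lia.
  rewrite leq_eqVlt => /andP[/predU1P[el|lj] lt4].
    have v : valid (inr (x, i, j.+1)) by rewrite /= xE lti.
    move: (exp_contour_fwd xE lti); rewrite /= el => <-.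
    by apply: reachS => //; rewrite exp_contour_fwd //= el exp_codom.
  have v : valid (inr (x, i, j.+1)) by rewrite /= xE lti.
  have nl : j.+1 != lvl x i by rewrite neq_ltn lj orbT.
  rewrite -exp_contour_stem //; apply: reachS; first by apply: IHj; lia.
  by rewrite exp_contour_stem ?exp_codom.
split=> [|j _]; last exact: h.
have v : valid (inr (x, i, 0%N)) by rewrite /= xE lti.
rewrite /fwd lti exp_rot_inv_inr0 //; apply: h.
by have := lvl_bounds x i; lia.
Qed.

Lemma reach_bwd' x i : x \in edges s -> (i <= size (w x))%N ->
  reachr (rot_inv s (mate s x)) (rot_inv r (e (fwd x i))).
Proof.
move=> xE lei; have [] := @reach_bwd x (size (w x) - i) xE (leq_subr _ _).
by rewrite subKn.
Qed.

(** The contour of the scheme as a first-return map. The three cases are a stem, an edge followed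
    along its orientation, and an edge followed against it. *)
Lemma exp_return z : exists2 h, reachr z h & contour r h = f (contour s z).
Proof.
rewrite -[contour s z]/(mate s (rot s z)); set y := rot s z.
have zE : z = rot_inv s y by rewrite rotK.
have [sy|ny] := boolP (is_stem s y).
  exists (f z); first exact: reach0.
  rewrite /contour (exp_rot E) // (exp_mate E) //= -/y sy.
  by rewrite /f (eqP sy).
have [oy|oy] := boolP (y \in out s).
  have yE : y \in edges s by rewrite inE ny.
  have [h _] := reach_fwd yE (leqnn _); rewrite -zE in h.
  by exists (rot_inv r (e (bwd y (size (w y))))); rewrite // exp_contour_bwd // /fwd ltnn.
have xE := edges_mate ny oy.
have := reach_bwd' xE (leq0n _); rewrite mateK -zE => h.
by exists (rot_inv r (e (fwd (mate s y) 0))); rewrite // exp_contour_fwd.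
Qed.

Lemma exp_cover h : exists z, reachr z h.
Proof.
have [[x _|[[x i] j] v] <-] := exp_surj E h; first by exists x; exact: reach0.
have /and3P[xE lti ltj] := v; have [lj|lj] := ltnP j (lvl x i).
  by exists (rot_inv s x); have [_ h'] := reach_fwd xE (ltnW lti); exact: h'.
exists (rot_inv s (mate s x)).
have [_ h'] := @reach_bwd x (size (w x) - i) xE (leq_subr _ _).
by rewrite subKn in h'; [apply: h'; rewrite // lj | exact: ltnW].
Qed.

Lemma exp_unicellular : unicellular r = unicellular s.
Proof.
have ret := exp_return; have cov := exp_cover.
apply/forallP/forallP => uni h; apply/forallP => h'.
  apply: (first_return_down exp_inl_inj ret).
  by move=> g g'; have /forallP := uni g; apply.
apply: (first_return_up (@contour_inj _ r) ret cov).
by move=> g g'; have /forallP := uni g; apply.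
Qed.

Lemma exp_root_corner : root_corner r = f (root_corner s).
Proof. by rewrite /root_corner (exp_root E) -exp_rot_inv_inl. Qed.

Hypothesis uni_s : unicellular s.

(** All segments of a path are traversed during the same two excursions between scheme corners, so
    the order of the two passes along a segment is the order of the two passes along the edge of the
    scheme. *)
Lemma exp_index x i : x \in edges s -> (i <= size (w x))%N ->
  (contour_index r (rot_inv r (e (fwd x i))) < contour_index r (rot_inv r (e (bwd x i))))%N
  = (contour_index s (rot_inv s (mate s x)) < contour_index s (rot_inv s x))%N.
Proof.
move=> xE lei; rewrite /contour_index exp_root_corner.
apply: (first_return_indexE (@contour_inj _ r) exp_inl_inj exp_return).
- have uni : unicellular r by rewrite exp_unicellular.
  by move=> g g'; move/forallP: uni => /(_ g)/forallP; apply.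
- apply: contraTneq isT => /perm_inj/eqP; rewrite -[_ == _]/(is_stem s x).
  by rewrite (edges_stem xE).
- exact: reach_bwd'.
by have [] := reach_fwd xE lei.
Qed.

Lemma exp_well_oriented : well_oriented r = well_oriented s.
Proof.
apply/forallP/forallP => wo.
  have woE x : x \in edges s ->
      (contour_index s (rot_inv s (mate s x)) < contour_index s (rot_inv s x))%N.
    move=> xE; have := wo (f x); rewrite exp_stem_inl (edges_stem xE) /=.
    rewrite (exp_out E) //= (edges_out xE) eq_sym => /eqP.
    rewrite (exp_mate E) //= (edges_stem xE) (edges_out xE).
    by rewrite -[f x]/(e (bwd x 0)) exp_index.
  move=> x; apply/implyP => nx; have [ox|ox] := boolP (x \in out s).
    by rewrite woE // inE nx.
  have := woE _ (edges_mate nx ox); rewrite mateK => lt.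
  by rewrite eq_sym eqbF_neg -leqNgt ltnW.
have woE x i : x \in edges s -> (i <= size (w x))%N ->
    (contour_index r (rot_inv r (e (fwd x i))) < contour_index r (rot_inv r (e (bwd x i))))%N.
  move=> xE lei; rewrite exp_index //; have /implyP/(_ _)/eqP <- := wo x.
    exact: edges_out.
  by rewrite (edges_stem xE).
move=> h; have [p vp <-] := exp_surj E h; rewrite exp_stem //.
have [x i xE lei ->|x i xE lei ->|->] := rawP vp; last by rewrite eqxx.
  rewrite exp_mate ?valid_fwd // exp_out ?valid_fwd // rawout_fwd // rawmate_fwd //.
  by rewrite (eq_sym false) eqbF_neg -leqNgt ltnW ?implybT // woE.
rewrite exp_mate ?valid_bwd // exp_out ?valid_bwd // rawout_bwd // rawmate_bwd //.
by rewrite woE ?implybT.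
Qed.

End Realization.
End Expansion.

(** * Labels of an expansion *)

(** What the counting needs to know about a scheme. No condition on labels appears: the labels of
    the scheme corners vary with the inserted words and are supplied separately by [labeling]. *)
Record good_scheme (S : finType) (s : bmap S) : Prop := GoodScheme {
  good_mateK : forall x, mate s (mate s x) = x;
  good_mate_out :
    forall x, ~~ is_stem s x -> (mate s x \in out s) = (x \notin out s);
  good_degree : forall x, degree s x = 4;
  good_in_scheme : forall x, in_scheme s x;
  good_unicellular : unicellular s;
  good_well_oriented : well_oriented s;
  good_root : is_bud s (root s) }.

(** The corners [rot_inv s x] and [mate s x] are the two ends of the right side of the edge starting
    with [x], so the last clause lets the label change along an edge by the displacement of its
    word. The left side is then governed by the second clause. *)
Definition labeling (S : finType) (s : bmap S) (w : S -> seq letter)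
    (l : S -> int) : Prop :=
  [/\ l (root_corner s) = 0,
      forall x, l (rot s x) = l x + updown (rot s x \in out s)
    & forall x, x \in edges s -> l (mate s x) = l (rot_inv s x) + wdisp (w x)].

Lemma wdisp_cat u v : wdisp (u ++ v) = wdisp u + wdisp v.
Proof. by rewrite /wdisp big_cat. Qed.

Lemma wdisp_take (u : seq letter) i : (i < size u)%N ->
  wdisp (take i.+1 u) = wdisp (take i u) + disp (nth letter0 u i).
Proof.
by move=> lti; rewrite (take_nth letter0) // -cats1 wdisp_cat /wdisp big_seq1.
Qed.

(** The clause with content is the one on [scheme_mate]: iterating [pass] goes through the [fwd]
    half-edges in increasing order from an outgoing half-edge, and through the [bwd] half-edges in
    decreasing order from an ingoing one. *)
Lemma exp_embedding (S H : finType) (s : bmap S) (w : S -> seq letter)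
    (r : bmap H) (e : raw S -> H) : good_scheme s -> expansion s w r e ->
  scheme_embedding s r [ffun x => e (inl x)].
Proof.
move=> gs E; pose f x := e (inl x).
have [mK mo d4 is_s uni wo rb] := gs.
have inj_f := exp_inl_inj E.
have scE := exp_in_scheme mK mo d4 E is_s.
have passE (x : S) i j k : x \in edges s -> (i < size (w x))%N ->
    (j < 4)%N -> (k < 4)%N -> j != k ->
    ~~ is_stem r (e (inr (x, i, j))) -> ~~ is_stem r (e (inr (x, i, k))) ->
    pass r (e (inr (x, i, j))) = mate r (e (inr (x, i, k))).
  move=> xE lti ltj ltk jk nj nk.
  have v n : (n < 4)%N -> valid s w (inr (x, i, n)) by rewrite /= xE lti.
  apply: pass_unique; rewrite ?(exp_interior_inr mK mo d4 E) ?v //; last first.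
    by rewrite (exp_eq E) ?v //; apply: contra jk => /eqP[->].
  have [m em] : exists m, iter m (@rawrot S s) (inr (x, i, j)) = inr (x, i, k).
    clear -ltj ltk.
    by case: j ltj => [|[|[|[|]]]] // _; case: k ltk => [|[|[|[|]]]] // _;
      solve [exists 0%N => // | exists 1%N => // | exists 2%N => // | exists 3%N => //].
  rewrite -em; have [_ <-] := exp_iter_rot E m (v j ltj).
  by rewrite -permX mem_porbit.
have stemE (x : S) i j : x \in edges s -> (i < size (w x))%N -> (j < 4)%N ->
    is_stem r (e (inr (x, i, j))) = (j != 0%N) && (j != lvl w x i).
  move=> xE lti ltj; have v : valid s w (inr (x, i, j)) by rewrite /= xE lti.
  by rewrite (exp_stem mK mo E) // rawmate_inr.
have mateE p : valid s w p -> mate r (e p) = e (rawmate s w p) by exact: (exp_mate E).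
have lb x i : (lvl w x i < 4)%N by have /andP[] := lvl_bounds w x i.
have ln x i : lvl w x i != 0%N by [].
apply/and5P; split.
- by apply/injectiveP => x y; rewrite !ffunE => /inj_f.
- apply/forallP => h; have [p vp <-] := exp_surj E h.
  rewrite scE //; have <- := exp_codom E vp.
  by apply/eqP; congr (_ \in _); apply: eq_codom => x; rewrite ffunE.
- by apply/forallP => x; rewrite !ffunE (exp_rot E).
- apply/forallP => x; rewrite !ffunE -/(f x).
  have [sx|nx] := boolP (is_stem s x).
    have m0 : mate r (f x) = f x.
      by apply/eqP; rewrite -[_ == _]/(is_stem r (f x)) (exp_stem_inl mK mo E).
    have is0 : in_scheme r (mate r (f x)) by rewrite m0 scE.
    by rewrite (eqP sx) (@scheme_mateP _ _ _ 0) // m0.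
  have [ox|ox] := boolP (x \in out s).
    have xE : x \in edges s by rewrite inE nx.
    have itE i : (i <= size (w x))%N ->
        iter i (pass r) (mate r (f x)) = e (fwd s w x i).
      elim: i => [|i IHi] lei.
        by rewrite -[iter 0 _ _]/(mate r (f x)) mateE // -[inl x]/(bwd w x 0) rawmate_bwd.
      rewrite iterS IHi 1?ltnW // {1}/fwd lei (passE x i 0%N (lvl w x i)) //.
      + have -> : inr (x, i, lvl w x i) = bwd w x i.+1 by [].
        by rewrite mateE ?valid_bwd // rawmate_bwd.
      + by rewrite stemE.
      + by rewrite stemE ?eqxx ?andbF.
    rewrite (@scheme_mateP _ _ _ (size (w x))) ?itE // /fwd ?ltnn //.
    + by move=> i lti; rewrite itE ?(ltnW lti) // /fwd lti scE //= xE lti.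
    + by rewrite scE.
  have yE := edges_mate mK mo nx ox; set y := mate s x in yE *.
  have yx : mate s y = x by rewrite mK.
  have itE i : (i <= size (w y))%N ->
      iter i (pass r) (mate r (f x)) = e (bwd w y (size (w y) - i)).
    elim: i => [|i IHi] lei.
      by rewrite /= subn0 mateE // -(rawmate_fwd mK mo) // /fwd ltnn yx.
    rewrite iterS IHi 1?ltnW // subnS.
    have [k ek] : exists k, (size (w y) - i)%N = k.+1.
      by exists (size (w y) - i).-1; rewrite prednK // subn_gt0.
    have ltk : (k < size (w y))%N by lia.
    rewrite ek [bwd w y k.+1]/bwd (passE y k (lvl w y k) 0%N) //.
    + rewrite mateE ?(rawmate_fwd mK mo) //= ?yE ?ltk //.
    + by rewrite stemE // eqxx andbF.
    + by rewrite stemE.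
  rewrite (@scheme_mateP _ _ _ (size (w y))) ?itE // ?subnn //.
  + move=> i lti; rewrite itE ?(ltnW lti) //.
    have [k ek] : exists k, (size (w y) - i)%N = k.+1.
      by exists (size (w y) - i).-1; rewrite prednK // subn_gt0.
    rewrite ek scE //; apply: valid_bwd => //; lia.
  + by rewrite scE.
- apply/andP; split; last by rewrite ffunE (exp_root E).
  by apply/forallP => x; rewrite ffunE (exp_out E).
Qed.

Section Labels.
Variables (S H : finType) (s : bmap S) (w : S -> seq letter).
Variables (r : bmap H) (e : raw S -> H).
Hypotheses (gs : good_scheme s) (E : expansion s w r e).

Let mK := good_mateK gs.
Let mo := good_mate_out gs.
Let d4 := good_degree gs.

Definition rawlabel (l : S -> int) (p : raw S) : int := match p with
  | inl x => l x
  | inr (x, i, j) => l (rot_inv s x) + wdisp (take i (w x))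
                     + letter_label (nth letter0 (w x) i) j end.

Lemma rawlabel_rot l p : labeling s w l -> valid s w p ->
  rawlabel l (rawrot s p) = rawlabel l p + updown (rawout s w (rawrot s p)).
Proof.
move=> [_ lr _]; case: p => [x _|[[x i] j] /and3P[xE lti ltj]]; first exact: lr.
have [-> {j ltj}|j3] := eqVneq j 3%N.
  by rewrite /rawlabel letter_label3 /= addr0 addrK.
by case: j ltj j3 => [|[|[|[|]]]] //= _ _; rewrite ?addrA.
Qed.

Lemma rawlabel_edge l x i : labeling s w l -> x \in edges s ->
  (i <= size (w x))%N -> rawlabel l (bwd w x i) = rawlabel l (fwd s w x i) + 1.
Proof.
move=> [_ lr lm] xE lei.
have bE : rawlabel l (bwd w x i) = l (rot_inv s x) + wdisp (take i (w x)) + 1.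
  case: i lei => [|i] lei.
    rewrite take0 /wdisp big_nil addr0 /=.
    by rewrite -{1}(rot_invK s x) lr rot_invK (edges_out xE).
  by rewrite wdisp_take // /bwd /rawlabel letter_label_lv !addrA.
rewrite bE /fwd; move: lei; rewrite leq_eqVlt => /predU1P[->|lti].
  by rewrite ltnn take_size /= lm.
by rewrite lti /= addr0.
Qed.

(** [rawlabel] is carried over to [H] and shown to follow the contour. Turning past a half-edge
    changes it by 1 or -1; at a stem this is the contour step, and at an edge it is undone by
    passing to the other end, by [rawlabel_edge]. *)
Lemma exp_labelE l : labeling s w l ->
  forall p, valid s w p -> label r (e p) = rawlabel l p.
Proof.
move=> lab.
have [lr lrE] : exists lr : H -> int,
    forall h p, valid s w p -> e p = h -> rawlabel l p = lr h.
  apply: (@fin_all_exists _ (fun=> int)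
     (fun h v => forall p, valid s w p -> e p = h -> rawlabel l p = v)) => h.
  have [p vp <-] := exp_surj E h; exists (rawlabel l p) => q vq.
  by move=> /(exp_inj E)-> .
suff lE : label r =1 lr by move=> p vp; rewrite lE; symmetry; apply: lrE.
apply: label_unique.
- by rewrite (exp_unicellular mK mo E) (good_unicellular gs).
- rewrite (exp_root_corner E) -(lrE _ (inl (root_corner s))) //.
  by have [] := lab.
move=> h; have [p vp <-] := exp_surj E h.
have vq := valid_rot vp; rewrite /contour (exp_rot E) // (exp_mate E) //.
rewrite -(lrE _ _ vp erefl) -(lrE _ _ (valid_mate mK mo vq) erefl).
have lq := rawlabel_rot lab vp.
rewrite /contour_step /is_bud /is_leaf (exp_stem mK mo E) // (exp_out E) //.
have [x i xE lei eq|x i xE lei eq|eq] := rawP mK mo vq.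
- rewrite eq (rawmate_fwd mK mo) // (rawlabel_edge lab xE lei).
  rewrite eq_sym (negbTE (fwd_neq_bwd w mo _ _)) //= addr0.
  by rewrite -eq lq eq rawout_fwd //= subrK.
- rewrite eq rawmate_bwd // (negbTE (fwd_neq_bwd w mo _ _)) //= addr0.
  apply: (addIr 1); rewrite -(rawlabel_edge lab xE lei).
  by rewrite -eq lq eq rawout_bwd.
by rewrite eq eqxx lq /=; case: (rawout _ _ _).
Qed.

Lemma exp_label_inl l x : labeling s w l -> label r (e (inl x)) = l x.
Proof. by move=> lab; rewrite (exp_labelE lab). Qed.

Lemma exp_inR l : labeling s w l -> inR r.
Proof.
move=> lab; have lE := exp_labelE lab.
have scE := exp_in_scheme mK mo d4 E (good_in_scheme gs).
have d4r := exp_degree d4 E.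
have uni : unicellular r.
  by rewrite (exp_unicellular mK mo E) (good_unicellular gs).
have riE p : valid s w p ->
    label r (rot_inv r (e p)) = label r (e p) - updown (rawout s w p).
  move=> vp; have [q vq eq] := exp_surj E (rot_inv r (e p)).
  have : e p = e (rawrot s q) by rewrite -(exp_rot E) // eq rot_invK.
  move/(exp_inj E) => /(_ vp (valid_rot vq)) ep.
  by rewrite -eq ep !lE ?valid_rot // (rawlabel_rot lab vq) addrK.
apply/and5P; split.
- apply/and4P; split.
  + by apply/forallP => h; rewrite (exp_mateK mK mo E).
  + apply/forallP => h; apply/implyP => nh.
    by rewrite (exp_mate_out mK mo E).
  + apply/forallP => h; apply/forallP => g.
    move: uni => /forallP/(_ h)/forallP/(_ g).
    apply: connect_sub => {}h _ /eqP <-.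
    apply: (@connect_trans _ _ (rot r h)); apply: connect1 => /=.
      by rewrite eqxx.
    by rewrite /contour eqxx orbT.
  + have := good_root gs; rewrite /is_bud (exp_root E) (exp_stem_inl mK mo E).
    by rewrite (exp_out E).
- exact: uni.
- apply/forallP => h; have [p vp <-] := exp_surj E h.
  case: p vp => [x vp|[[x i] j] vp].
    by apply: ltnW; have := scE _ vp.
  by rewrite (exp_interior_inr mK mo d4 E).
- by apply/forallP => h; rewrite d4r.
apply/and3P; split.
- by rewrite (exp_well_oriented mK mo E (good_unicellular gs)) (good_well_oriented gs).
- apply/andP; split; apply/forallP => h; have [p vp <-] := exp_surj E h.
    rewrite (exp_stem mK mo E) //.
    have [x i xE lei ->|x i xE lei ->|->] := rawP mK mo vp; last by rewrite eqxx.
      rewrite (exp_mate E) ?valid_fwd // (rawmate_fwd mK mo) // riE ?valid_bwd //.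
      by rewrite !lE ?valid_fwd ?valid_bwd // (rawlabel_edge lab) //
        rawout_bwd // addrK eqxx implybT.
    rewrite (exp_mate E) ?valid_bwd // rawmate_bwd // riE ?valid_fwd //.
    by rewrite !lE ?valid_fwd ?valid_bwd // (rawlabel_edge lab) //
      rawout_fwd // opprK eqxx implybT.
  by rewrite riE // (exp_out E) //; case: ifP => ->; rewrite ?subrK ?opprK.
by rewrite (exp_root E) scE.
Qed.

(** The labels on the right side of a path are computed from vertex to vertex: turning from the
    entrance to the exit accumulates [letter_label], whose value at the exit is the displacement of
    the letter plus 1. *)
Lemma exp_labeling : well_labeled r -> labeling s w (fun x => label r (e (inl x))).
Proof.
move=> /andP[/forallP wl1 /forallP wl2].
have rotE h : label r (rot r h) = label r h + updown (rot r h \in out r).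
  have := wl2 (rot r h); rewrite rotK.
  by case: ifP => _ /eqP ->; rewrite ?addrK.
have riE h : label r (rot_inv r h) = label r h - updown (h \in out r).
  by rewrite -{2 3}(rot_invK r h) rotE addrK.
split=> [|x|x xE].
- by rewrite -(exp_root_corner E) label_root_corner.
- by rewrite -[inl _]/(rawrot s (inl x)) -(exp_rot E) // rotE (exp_rot E) //= (exp_out E).
have edgeE i : (i <= size (w x))%N ->
    label r (e (bwd w x i)) = label r (e (fwd s w x i)) + 1.
  move=> lei; have := wl1 (e (fwd s w x i)); rewrite (exp_stem mK mo E) ?valid_fwd //.
  rewrite (rawmate_fwd mK mo) // eq_sym (fwd_neq_bwd w mo) //= (exp_mate E) ?valid_fwd //.
  by rewrite (rawmate_fwd mK mo) // riE (exp_out E) ?valid_bwd //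
    rawout_bwd // => /eqP->; rewrite subrK.
have fE i : (i <= size (w x))%N -> label r (e (fwd s w x i)) =
    label r (rot_inv r (e (inl x))) + wdisp (take i (w x)).
  elim: i => [|i IHi] lei.
    rewrite take0 /wdisp big_nil addr0 riE (exp_out E) //= (edges_out xE).
    by rewrite -[inl x]/(bwd w x 0) edgeE // addrK.
  apply: (addIr 1); rewrite -edgeE // wdisp_take // addrA -IHi 1?ltnW // -addrA.
  rewrite -letter_label_lv -/(lvl w x i) /bwd /fwd lei.
  have : (lvl w x i < 4)%N by have /andP[] := lvl_bounds w x i.
  elim: (lvl w x i) => [|j IHj] ltj; first by rewrite addr0.
  have vj : valid s w (inr (x, i, j)) by rewrite /= xE lei ltnW.
  have := rotE (e (inr (x, i, j))); rewrite (exp_rot E) // (exp_out E) ?valid_rot //.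
  rewrite IHj 1?ltnW // -addrA.
  by case: j ltj {IHj vj} => [|[|[|]]].
have := fE _ (leqnn _); rewrite /fwd ltnn take_size => ->.
by rewrite (exp_rot_inv_inl E).
Qed.

End Labels.

(** * Size, existence and uniqueness of expansions *)

Lemma n_leavesE (H : finType) (r : bmap H) : n_leaves r = (\sum_h is_leaf r h)%N.
Proof.
rewrite /n_leaves cardsE -sum1_card big_mkcond /=; apply: eq_bigr => h _.
by rewrite -[_ \in _]/(is_leaf r h); case: (is_leaf r h).
Qed.

Section RawList.
Variables (S : finType) (s : bmap S) (w : S -> seq letter).

Definition rawlist : seq (raw S) :=
  [seq inl x | x <- enum S] ++
  [seq inr (x, ij.1, ij.2) | x <- enum (edges s),
     ij <- [seq (i, j) | i <- iota 0 (size (w x)), j <- iota 0 4]].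

Lemma mem_rawlist p : (p \in rawlist) = valid s w p.
Proof.
rewrite mem_cat; case: p => [x|[[x i] j]].
  by rewrite mem_map ?mem_enum //; move=> ? ? [].
have -> : (inr (x, i, j) \in [seq inl x | x <- enum S]) = false.
  by apply/negbTE/mapP => -[].
apply/allpairsPdep/idP => [[y [[k l] [yE /allpairsPdep[k' [l' [hk hl [-> ->]]]] [-> -> ->]]]]|].
  by move: yE hk hl; rewrite mem_enum !mem_iota /= => -> -> ->.
case/and3P=> xE lti ltj; exists x, (i, j); split; rewrite ?mem_enum //.
by apply/allpairsPdep; exists i, j; rewrite !mem_iota /= lti ltj.
Qed.

Lemma rawlist_uniq : uniq rawlist.
Proof.
rewrite cat_uniq; apply/and3P; split.
- by rewrite map_inj_uniq ?enum_uniq // => ? ? [].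
- by apply/hasPn => p /allpairsPdep[x [ij [_ _ ->]]]; apply/negP => /mapP[].
apply: allpairs_uniq_dep; first exact: enum_uniq.
- by move=> x _; apply: allpairs_uniq; rewrite ?iota_uniq // => -[? ?] [? ?].
by move=> [x [i j]] [x' [i' j']] _ _ /= [-> -> ->].
Qed.

Lemma big_rawlist (F : raw S -> nat) : (\sum_(p <- rawlist) F p =
  \sum_x F (inl x) +
  \sum_(x in edges s) \sum_(i < size (w x)) \sum_(j < 4) F (inr (x, val i, val j)))%N.
Proof.
rewrite big_cat big_map big_allpairs_dep !big_enum; congr (_ + _)%N.
apply: eq_bigr => x _; rewrite big_allpairs_dep -{1}(subn0 (size (w x))) -/(index_iota 0 _).
by rewrite big_mkord; apply: eq_bigr => i _; rewrite -[iota 0 4]/(index_iota 0 4) big_mkord.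
Qed.

Lemma size_rawlist : size rawlist = (#|S| + 4 * \sum_(x in edges s) size (w x))%N.
Proof.
rewrite -sum1_size big_rawlist sum1_card big_distrr /=; congr (_ + _)%N.
apply: eq_bigr => x _; under eq_bigr do rewrite sum1_card card_ord.
by rewrite sum_nat_const card_ord mulnC.
Qed.

Section Count.
Variables (H : finType) (r : bmap H) (e : raw S -> H).
Hypotheses (gs : good_scheme s) (E : expansion s w r e).

Lemma exp_enum : perm_eq (enum H) (map e rawlist).
Proof.
apply: uniq_perm; first exact: enum_uniq.
  rewrite map_inj_in_uniq ?rawlist_uniq // => p q.
  by rewrite !mem_rawlist; exact: (exp_inj E).
move=> h; rewrite mem_enum; have [p vp <-] := exp_surj E h.
by rewrite map_f // mem_rawlist.
Qed.

Lemma exp_card : #|H| = (#|S| + 4 * \sum_(x in edges s) size (w x))%N.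
Proof. by rewrite -size_rawlist cardE (perm_size exp_enum) size_map. Qed.

Lemma exp_n_leaves : n_leaves r = (n_leaves s + \sum_(x in edges s) size (w x))%N.
Proof.
have stemE := exp_stem (good_mateK gs) (good_mate_out gs) E.
rewrite !n_leavesE -big_enum (perm_big _ exp_enum) big_map /= big_rawlist.
congr (_ + _)%N.
  by apply: eq_bigr => x _; rewrite /is_leaf stemE // (exp_out E) // rawmate_inl.
apply: eq_bigr => x xE; rewrite -[RHS]card_ord -sum1_card; apply: eq_bigr => i _.
have leafE (j : 'I_4) : is_leaf r (e (inr (x, val i, val j))) =
    [&& val j != 0%N, val j != lvl w x i & ~~ letter_out (nth letter0 (w x) i) j].
  have v : valid s w (inr (x, val i, val j)) by rewrite /= xE !ltn_ord.
  by rewrite /is_leaf stemE // (exp_out E) // rawmate_inr //= -?andbA; case: (_ == 0%N).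
under eq_bigr => j _ do rewrite leafE.
rewrite /lvl !big_ord_recl big_ord0.
by case: (nth _ _ _) => [[[|[|[|k]]] lt] []].
Qed.

End Count.

(** The half-edges are numbered by their positions in [rawlist]; [d] and [e] are the two directions
    of this numbering. *)
Lemma expansion_exists m : good_scheme s -> m = size rawlist ->
  exists (r : bmap 'I_m) (e : raw S -> 'I_m), expansion s w r e.
Proof.
move=> gs em; have p0 : raw S := inl (root s).
have m0 : (0 < m)%N.
  rewrite em; have : inl (root s) \in rawlist by rewrite mem_rawlist.
  by case: rawlist.
case: m m0 em => // m _ em.
pose e (p : raw S) : 'I_m.+1 := inord (index p rawlist).
pose d (h : 'I_m.+1) := nth p0 rawlist h.
have dv h : valid s w (d h) by rewrite -mem_rawlist mem_nth // -em.
have dK h : e (d h) = h.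
  by rewrite /e /d index_uniq ?rawlist_uniq -?em // inord_val.
have eK p : valid s w p -> d (e p) = p.
  rewrite -mem_rawlist => vp; rewrite /d /e inordK ?nth_index //.
  by rewrite em index_mem.
have mK := good_mateK gs; have mo := good_mate_out gs; have d4 := good_degree gs.
have rI : injective (fun h => e (rawrot s (d h))).
  move=> h h' /(congr1 d); rewrite !eK ?valid_rot // => /(rawrot_inj d4).
  by move=> /(_ w (dv h) (dv h'))/(congr1 e); rewrite !dK.
have mI : injective (fun h => e (rawmate s w (d h))).
  move=> h h' /(congr1 d); rewrite !eK ?valid_mate // => /(congr1 (rawmate s w)).
  by rewrite !(rawmateK mK mo) // => /(congr1 e); rewrite !dK.
exists (BMap (perm rI) (perm mI) [set h | rawout s w (d h)] (e (inl (root s)))), e.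
split=> //.
- by move=> p q vp vq /(congr1 d); rewrite !eK.
- by move=> h; exists (d h).
- by move=> p vp; rewrite permE eK.
- by move=> p vp; rewrite permE eK.
- by move=> p vp; rewrite inE eK.
Qed.

End RawList.

Lemma expansion_iso (S H : finType) (s : bmap S) (w : S -> seq letter)
    (r r' : bmap H) (e e' : raw S -> H) : good_scheme s ->
  expansion s w r e -> expansion s w r' e' -> map_iso r r'.
Proof.
move=> gs E E'; have mK := good_mateK gs; have mo := good_mate_out gs.
have [g gE] : exists g : H -> H, forall h p, valid s w p -> e p = h -> e' p = g h.
  apply: (@fin_all_exists _ (fun=> H)
     (fun h v => forall p, valid s w p -> e p = h -> e' p = v)) => h.
  have [p vp <-] := exp_surj E h; exists (e' p) => q vq.
  by move=> /(exp_inj E)->.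
have {}gE p : valid s w p -> g (e p) = e' p by move=> vp; rewrite -(gE _ p).
have gI : injective g.
  move=> h h'; have [p vp <-] := exp_surj E h; have [q vq <-] := exp_surj E h'.
  by rewrite !gE // => /(exp_inj E')->.
apply/existsP; exists (perm gI); apply/and4P; split.
- apply/forallP => h; have [p vp <-] := exp_surj E h.
  by rewrite !permE (exp_rot E) // !gE ?valid_rot // (exp_rot E').
- apply/forallP => h; have [p vp <-] := exp_surj E h.
  by rewrite !permE (exp_mate E) // !gE ?valid_mate // (exp_mate E').
- apply/forallP => h; have [p vp <-] := exp_surj E h.
  by rewrite !permE gE // (exp_out E) // (exp_out E').
by rewrite !permE (exp_root E) gE // (exp_root E').
Qed.

Lemma iso_expansion (S H : finType) (s : bmap S) (w : S -> seq letter)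
    (r r' : bmap H) (e : raw S -> H) :
  expansion s w r e -> map_iso r r' -> exists e', expansion s w r' e'.
Proof.
move=> E /existsP[g /and4P[/forallP gr /forallP gm /forallP go /eqP groot]].
exists (fun p => g (e p)); split.
- by move=> p q vp vq /perm_inj; exact: (exp_inj E).
- move=> h; have [p vp ep] := exp_surj E ((g^-1)%g h); exists p => //.
  by rewrite ep permKV.
- by move=> p vp; rewrite -(eqP (gr _)) (exp_rot E).
- by move=> p vp; rewrite -(eqP (gm _)) (exp_mate E).
- by move=> p vp; rewrite (eqP (go _)) (exp_out E).
by rewrite -groot (exp_root E).
Qed.

(** The image of the root is prescribed and the image of the next corner is determined by that of
    the current one, while the contour of the scheme reaches every half-edge. *)
Lemma embedding_unique (S H : finType) (s : bmap S) (r : bmap H)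
    (f f' : {ffun S -> H}) : good_scheme s ->
  scheme_embedding s r f -> scheme_embedding s r f' -> f =1 f'.
Proof.
move=> gs /and5P[_ _ /forallP fr /forallP fm /andP[_ /eqP f0]].
move=> /and5P[_ _ /forallP fr' /forallP fm' /andP[_ /eqP f0']].
apply: (unicellular_ind (good_unicellular gs) (h0 := root s)); first by rewrite f0 f0'.
move=> x ex; rewrite /contour (eqP (fm _)) (eqP (fm' _)).
by rewrite (eqP (fr _)) (eqP (fr' _)) ex.
Qed.

(** The words are read off the map. Both parametrisations start from the same scheme half-edge; if
    they enter a vertex by the same half-edge, they read the same letter there and leave by the same
    half-edge. Both words end when a scheme vertex is met. *)
Lemma expansion_unique (S H : finType) (s : bmap S) (w w' : S -> seq letter)
    (r : bmap H) (e e' : raw S -> H) : good_scheme s ->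
  expansion s w r e -> expansion s w' r e' -> {in edges s, w =1 w'}.
Proof.
move=> gs E E' x xE.
have mK := good_mateK gs; have mo := good_mate_out gs; have d4 := good_degree gs.
have is_s := good_in_scheme gs.
have fE y : e (inl y) = e' (inl y).
  have := embedding_unique gs (exp_embedding gs E) (exp_embedding gs E') y.
  by rewrite !ffunE.
have scE := exp_in_scheme mK mo d4 E is_s; have scE' := exp_in_scheme mK mo d4 E' is_s.
have sizeE i : (i <= size (w x))%N -> (i <= size (w' x))%N ->
    e (fwd s w x i) = e' (fwd s w' x i) -> (i < size (w x))%N = (i < size (w' x))%N.
  move=> lei lei' ei.
  have := scE _ (valid_fwd w i xE); rewrite ei (scE' _ (valid_fwd w' i xE)).
  by rewrite /fwd; do 2!case: ifP.
have step i : (i < size (w x))%N -> (i < size (w' x))%N ->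
    e (fwd s w x i) = e' (fwd s w' x i) ->
    nth letter0 (w x) i = nth letter0 (w' x) i.
  move=> lti lti'; rewrite /fwd lti lti' => ei.
  have v j : (j < 4)%N -> valid s w (inr (x, i, j)) by rewrite /= xE lti.
  have v' j : (j < 4)%N -> valid s w' (inr (x, i, j)) by rewrite /= xE lti'.
  have eS j : (j < 3)%N -> e (inr (x, i, j)) = e' (inr (x, i, j)) ->
      e (inr (x, i, j.+1)) = e' (inr (x, i, j.+1)).
    move=> ltj /(congr1 (rot r)); rewrite (exp_rot E) ?(exp_rot E') ?v ?v' ?(leqW ltj) //=.
    by case: j ltj => [|[|[|]]].
  have e1 := eS 0%N isT ei; have e2 := eS 1%N isT e1;
  have st j : (j < 4)%N -> e (inr (x, i, j)) = e' (inr (x, i, j)) ->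
      (j != 0%N) && (j != lvl w x i) = (j != 0%N) && (j != lvl w' x i).
    move=> ltj ej; rewrite -!(rawmate_inr s) // -(exp_stem mK mo E) ?v // ej.
    by rewrite (exp_stem mK mo E') ?v'.
  have ot j : (j < 4)%N -> e (inr (x, i, j)) = e' (inr (x, i, j)) ->
      letter_out (nth letter0 (w x) i) j = letter_out (nth letter0 (w' x) i) j.
    by move=> ltj ej; have := exp_out E (v _ ltj); rewrite ej (exp_out E') ?v' //= => ->.
  (* Half-edges 1 and 2 determine the letter: knowing which of them are stems gives the exit, and
     one of them is the first stem. *)
  move: (st 1%N isT e1) (st 2%N isT e2) (ot 1%N isT e1) (ot 2%N isT e2).
  rewrite /lvl; move: (nth _ (w x) i) (nth _ (w' x) i) => [q b] [q' b'].
  case: q => [[|[|[|q]]] ltq] //; case: q' => [[|[|[|q']]] ltq'] // _ _ /=;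
    rewrite /letter_out /= => h h'; congr (_, _); rewrite ?h ?h' //; exact: val_inj.
have main i : (i <= size (w x))%N -> (i <= size (w' x))%N /\
   e (fwd s w x i) = e' (fwd s w' x i) /\ take i (w x) = take i (w' x).
  elim: i => [|i IHi] lei.
    split=> //; split; last by rewrite !take0.
    rewrite -!(@rawmate_bwd _ _ _ x 0) // -(exp_mate E) // -(exp_mate E') //=.
    by rewrite fE.
  have [lei' [ei et]] := IHi (ltnW lei).
  have lti' : (i < size (w' x))%N by rewrite -(sizeE i) // ltnW.
  split=> //; have en := step i lei lti' ei.
  split; last by rewrite !(take_nth letter0) // et en.
  rewrite -!(@rawmate_bwd _ _ _ x i.+1) // -(exp_mate E) ?valid_bwd //.
  rewrite -(exp_mate E') ?valid_bwd //; congr (mate r _).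
  rewrite /bwd /lvl en; move: ei; rewrite /fwd lei lti' => ei.
  have : (lv (nth letter0 (w' x) i) < 4)%N by have /andP[] := lvl_bounds w' x i.
  elim: (lv _) => // j IHj ltj.
  have vj : valid s w (inr (x, i, j)) by rewrite /= xE lei ltnW.
  have vj' : valid s w' (inr (x, i, j)) by rewrite /= xE lti' ltnW.
  have := congr1 (rot r) (IHj (ltnW ltj)); rewrite (exp_rot E) // (exp_rot E') //=.
  by case: j ltj {IHj vj vj'} => [|[|[|]]].
have [le [ee et]] := main _ (leqnn _).
have := sizeE _ (leqnn _) le ee; rewrite ltnn => /esym/negbT; rewrite -leqNgt => ge.
by rewrite -(take_size (w x)) et take_oversize.
Qed.

(** * Every map is an expansion of its scheme *)

Section Walks.
Variables (H : finType) (r : bmap H).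
Hypothesis rR : inR r.
Implicit Types h g : H.

Lemma inR_mateK h : mate r (mate r h) = h.
Proof. by have /and5P[/and4P[/forallP/(_ h)/eqP]] := rR. Qed.

Lemma inR_mate_out h : ~~ is_stem r h -> (mate r h \in out r) = (h \notin out r).
Proof. by have /and5P[/and4P[_ /forallP/(_ h)/implyP m _ _] _ _ _ _] := rR => /m/eqP. Qed.

Lemma inR_degree h : degree r h = 4.
Proof. by have /and5P[_ _ _ /forallP/(_ h)/eqP] := rR. Qed.

Lemma inR_interior h : ~~ in_scheme r h -> interior_degree r h = 2.
Proof.
have /and5P[_ _ /forallP/(_ h) lt _ _] := rR.
by rewrite -leqNgt => le; apply/eqP; rewrite eqn_leq le.
Qed.

Lemma inR_unicellular : unicellular r.
Proof. by have /and5P[_ ] := rR. Qed.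

Lemma inR_well_oriented h : ~~ is_stem r h -> (h \in out r) =
  (contour_index r (rot_inv r (mate r h)) < contour_index r (rot_inv r h))%N.
Proof.
by have /and5P[_ _ _ _ /and3P[/forallP/(_ h)/implyP wo _ _]] := rR => /wo/eqP.
Qed.

Lemma inR_well_labeled : well_labeled r.
Proof. by have /and5P[_ _ _ _ /and3P[]] := rR. Qed.

Lemma inR_root_scheme : in_scheme r (root r).
Proof. by have /and5P[_ _ _ _ /and3P[]] := rR. Qed.

Lemma inR_root_bud : is_bud r (root r).
Proof. by have /and5P[/and4P[]] := rR. Qed.

Let d4 := inR_degree.

Lemma inR_stem_mate h : is_stem r (mate r h) = is_stem r h.
Proof. by rewrite /is_stem inR_mateK eq_sym. Qed.

Lemma label_rot h : label r (rot r h) = label r h + updown (rot r h \in out r).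
Proof.
have /andP[_ /forallP/(_ (rot r h))] := inR_well_labeled; rewrite rotK.
by case: ifP => _ /eqP ->; rewrite ?addrK.
Qed.

(** A full turn around the vertex restores the label; hence two half-edges go out and two come
    in. *)
Lemma updown_vertex h : updown (rot r h \in out r) +
  updown (rot r (rot r h) \in out r) + updown (rot r (rot r (rot r h)) \in out r)
  + updown (h \in out r) = 0.
Proof.
apply: (addrI (label r h)); rewrite addr0 !addrA -!label_rot.
by rewrite -{2}(rot4 d4 h) -label_rot (rot4 d4).
Qed.

(** The index fails to increase only on returning to the root corner, which lies at a scheme
    vertex. *)
Lemma contour_index_next h : ~~ in_scheme r (contour r h) ->
  contour_index r (contour r h) = (contour_index r h).+1.
Proof.
move=> nsc; apply: findex_next; first exact: contour_inj.
  by have /forallP/(_ (root_corner r))/forallP := inR_unicellular; apply.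
apply: contraNneq nsc => ->; rewrite in_scheme_rot_inv //.
exact: inR_root_scheme.
Qed.

Lemma contour_index_inj : injective (contour_index r).
Proof.
have /forallP/(_ (root_corner r))/forallP uni := inR_unicellular.
move=> h g; rewrite /contour_index => e.
by have := iter_findex (uni h); rewrite e iter_findex.
Qed.

(* At a vertex of interior degree 2 entered by [h], the path leaves by
   [iter (exit h) (rot r) h]. *)
Definition exit h : nat :=
  if ~~ is_stem r (rot r h) then 1%N else
  if ~~ is_stem r (rot r (rot r h)) then 2%N else 3%N.

Lemma exit_bounds h : (0 < exit h < 4)%N.
Proof. by rewrite /exit; case: ifP => // _; case: ifP. Qed.

Section Path.
Variable h : H.
Hypotheses (nh : ~~ is_stem r h) (ph : ~~ in_scheme r h).

Lemma exitP j : (0 < j < 4)%N -> ~~ is_stem r (iter j (rot r) h) = (j == exit h).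
Proof.
have := inR_interior ph; rewrite (interior_degree4 d4) nh /exit.
case: j => [|[|[|[|j]]]] //=;
by case: (is_stem r (rot r h)); case: (is_stem r (rot r (rot r h)));
   case: (is_stem r (rot r (rot r (rot r h)))).
Qed.

Definition leave := iter (exit h) (rot r) h.

Lemma leave_stem : ~~ is_stem r leave.
Proof. by rewrite exitP ?eqxx // exit_bounds. Qed.

Lemma leave_scheme : ~~ in_scheme r leave.
Proof. by rewrite in_scheme_iter. Qed.

Lemma passE : pass r h = mate r leave.
Proof.
apply: pass_unique nh leave_stem; first exact: inR_interior.
  by rewrite /leave -permX mem_porbit.
apply/eqP => e; have := @rot_iter_inj _ r d4 h (exit h) 0%N.
by have /andP[l0 l4] := exit_bounds h => /(_ l4 isT e); lia.
Qed.

End Path.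

Lemma exit_leave h : ~~ is_stem r h -> ~~ in_scheme r h ->
  exit (leave h) = (4 - exit h)%N.
Proof.
move=> nh ph; have := exitP (leave_stem nh ph) (leave_scheme ph) (j := 4 - exit h).
have /andP[l0 l4] := exit_bounds h.
rewrite /leave -iterD subnK ?(ltnW l4) //= (rot4 d4) nh.
by move=> e; apply/esym/eqP/esym/e; lia.
Qed.

Lemma leaveK h : ~~ is_stem r h -> ~~ in_scheme r h -> leave (leave h) = h.
Proof.
move=> nh ph; rewrite {1}/leave exit_leave // /leave -iterD subnK.
  exact: (rot4 d4).
by have := exit_bounds h; lia.
Qed.

Lemma contour_exit h j : ~~ is_stem r h -> ~~ in_scheme r h -> (j.+1 < exit h)%N ->
  contour r (iter j (rot r) h) = iter j.+1 (rot r) h.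
Proof.
move=> nh ph ltj; apply/eqP; rewrite -[_ == _]/(is_stem r (iter j.+1 (rot r) h)).
rewrite -[is_stem _ _]negbK exitP // ?neq_ltn ?ltj //.
by have := exit_bounds h; lia.
Qed.

Lemma contour_index_exit h j : ~~ is_stem r h -> ~~ in_scheme r h -> (j < exit h)%N ->
  contour_index r (iter j (rot r) h) = (contour_index r (rot_inv r (mate r h)) + j.+1)%N.
Proof.
move=> nh ph; elim: j => [|j IHj] ltj.
  have c : contour r (rot_inv r (mate r h)) = h by rewrite /contour rot_invK inR_mateK.
  by have := @contour_index_next (rot_inv r (mate r h)); rewrite c addn1 => ->.
rewrite -contour_exit // contour_index_next; first by rewrite IHj ?addnS // ltnW.
by rewrite contour_exit // in_scheme_iter.
Qed.

Lemma contour_index_leave h : ~~ is_stem r h -> ~~ in_scheme r h ->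
  contour_index r (rot_inv r (leave h)) =
  (contour_index r (rot_inv r (mate r h)) + exit h)%N.
Proof.
move=> nh ph; have /andP[l0 l4] := exit_bounds h.
rewrite -(prednK l0) -contour_index_exit ?prednK //; congr contour_index.
by apply: (@perm_inj _ (rot r)); rewrite rot_invK -iterS prednK.
Qed.

(** An oriented path stays oriented through a vertex of interior degree 2. The contour passes this
    vertex twice, during two intervals of indices starting after [A] and after [B]. By good
    orientation, [h] and [leave h] are both ingoing only if each interval precedes the other, which
    is absurd, and both outgoing only if the intervals overlap, which would give two distinct
    corners the same index. *)
Lemma leave_out h : ~~ is_stem r h -> ~~ in_scheme r h ->
  (leave h \in out r) = (h \notin out r).
Proof.
move=> nh ph; have ng := leave_stem nh ph; have pg := leave_scheme ph.
have eg := exit_leave nh ph; have lh := exit_bounds h.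
rewrite !inR_well_oriented // contour_index_leave //.
have := contour_index_leave ng pg; rewrite leaveK // => ->.
have ih j := contour_index_exit nh ph (j := j).
have ig j := contour_index_exit ng pg (j := j).
set A := contour_index r (rot_inv r (mate r h)) in ih *.
set B := contour_index r (rot_inv r (mate r (leave h))) in ig *.
have [lt1|] := ltnP A; last by lia.
apply/negbTE; rewrite -leqNgt leqNgt; apply/negP => lt2.
have [le|lt] := leqP A B.
  have : contour_index r (iter (B - A) (rot r) h) = contour_index r (iter 0 (rot r) (leave h)).
    by rewrite ih ?ig; lia.
  by move/contour_index_inj/(rot_iter_inj d4); lia.
have : contour_index r (iter (A - B) (rot r) (leave h)) = contour_index r (iter 0 (rot r) h).
  by rewrite ih ?ig; lia.
move/contour_index_inj; rewrite -{2}(leaveK nh ph).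
by move/(rot_iter_inj d4); lia.
Qed.

Definition walk h i := iter i (pass r) (mate r h).
Definition walking h K := forall i, (i < K)%N -> ~~ in_scheme r (walk h i).

Lemma walkingW h K i : walking h K -> (i <= K)%N -> walking h i.
Proof. by move=> wK lei j ltj; apply: wK; exact: leq_trans lei. Qed.

Lemma walk_stem h i : ~~ is_stem r h -> walking h i -> ~~ is_stem r (walk h i).
Proof.
move=> nh; elim: i => [|i IHi] wi; first by rewrite inR_stem_mate.
have ni := IHi (walkingW wi (leqnSn i)).
by rewrite /walk iterS passE ?wi // inR_stem_mate leave_stem ?wi.
Qed.

Lemma walkS h i : ~~ is_stem r h -> walking h i.+1 ->
  walk h i.+1 = mate r (leave (walk h i)).
Proof.
move=> nh wi; rewrite /walk iterS passE //; last exact: wi.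
exact: walk_stem nh (walkingW wi (leqnSn i)).
Qed.

Lemma walk_out h i : ~~ is_stem r h -> walking h i ->
  (walk h i \in out r) = (h \notin out r).
Proof.
move=> nh; elim: i => [|i IHi] wi; first exact: inR_mate_out.
have wi' := walkingW wi (leqnSn i); have ni := walk_stem nh wi'.
have pi : ~~ in_scheme r (walk h i) by exact: wi.
rewrite walkS // inR_mate_out ?leave_stem // leave_out // negbK.
exact: IHi.
Qed.

Lemma mate_inj : injective (mate r).
Proof. exact: perm_inj. Qed.

(** Since [leave] is an involution, two walks that meet can be run backwards together. They reach
    their starts simultaneously, because a start lies at a scheme vertex and the vertices passed on
    the way do not. *)
Lemma walk_inj h h' i i' : ~~ is_stem r h -> ~~ is_stem r h' ->
  in_scheme r h -> in_scheme r h' -> walking h i -> walking h' i' ->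
  walk h i = walk h' i' -> h = h' /\ i = i'.
Proof.
move=> nh nh' sh sh'; elim: i i' => [|i IHi] [|i'] wi wi'.
- by move/mate_inj.
- rewrite walkS // => /mate_inj eh.
  by case/negP: (leave_scheme (wi' _ (ltnSn i'))); rewrite -eh.
- rewrite walkS // => /mate_inj eh.
  by case/negP: (leave_scheme (wi _ (ltnSn i))); rewrite eh.
have w0 := walkingW wi (leqnSn i); have w0' := walkingW wi' (leqnSn i').
rewrite !walkS // => /mate_inj/(congr1 leave); rewrite !leaveK ?wi ?wi' //; last first.
- exact: walk_stem.
- exact: walk_stem.
by move=> /(IHi _ w0 w0')[-> ->].
Qed.

(** A walk that never met a scheme vertex would visit [#|H| + 1] distinct half-edges, by
    [walk_inj]. *)
Lemma walk_end h : ~~ is_stem r h -> in_scheme r h ->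
  exists K, walking h K /\ in_scheme r (walk h K).
Proof.
move=> nh sh; have ex : exists n, in_scheme r (walk h n).
  have [/existsP[i si]|/existsPn no] := boolP [exists i : 'I_#|H|.+1, in_scheme r (walk h i)].
    by exists i.
  have wN : walking h #|H|.+1 by move=> i lti; exact: (no (Ordinal lti)).
  have inj : injective (fun i : 'I_#|H|.+1 => walk h i).
    move=> i j /(walk_inj nh nh sh sh (walkingW wN (ltnW (ltn_ord i)))).
    by move=> /(_ (walkingW wN (ltnW (ltn_ord j))))[_ /val_inj].
  by have := leq_card _ inj; rewrite card_ord ltnn.
exists (ex_minn ex); case: ex_minnP => K sK min; split=> // i ltiK.
by apply: contraL ltiK => /min; rewrite -leqNgt.
Qed.

Lemma walk_rev h K i : ~~ is_stem r h -> walking h K -> (i <= K)%N ->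
  walk (walk h K) i = mate r (walk h (K - i)).
Proof.
move=> nh wK; elim: i => [|i IHi] lei; first by rewrite subn0.
rewrite /walk iterS -/(walk _ i) IHi 1?ltnW //.
have [k ek] : exists k, (K - i)%N = k.+1 by exists (K - i).-1; rewrite prednK // subn_gt0.
have wk : walking h k.+1 by apply: walkingW wK _; rewrite -ek leq_subr.
have nk : ~~ is_stem r (walk h k) by exact: walk_stem nh (walkingW wk (leqnSn k)).
have pk : ~~ in_scheme r (walk h k) by exact: wk.
rewrite subnS ek walkS // inR_mateK passE ?leave_stem ?leave_scheme //.
by rewrite leaveK.
Qed.

Lemma scheme_mate_walk h K : walking h K -> in_scheme r (walk h K) ->
  scheme_mate r h = walk h K.
Proof. exact: scheme_mateP. Qed.

Lemma scheme_mate_stem h : is_stem r h -> in_scheme r h -> scheme_mate r h = h.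
Proof. by move=> /eqP mh sh; rewrite (@scheme_mate_walk _ 0) // /walk /= mh. Qed.

Lemma scheme_mateK h : in_scheme r h -> scheme_mate r (scheme_mate r h) = h.
Proof.
move=> sh; have [st|nh] := boolP (is_stem r h); first by rewrite !scheme_mate_stem.
have [K [wK sK]] := walk_end nh sh; rewrite (scheme_mate_walk wK sK).
have wE i (lei : (i <= K)%N) := walk_rev nh wK lei.
rewrite (@scheme_mate_walk _ K); first by rewrite wE // subnn inR_mateK.
  move=> i lti; rewrite wE ?(ltnW lti) //.
  have [k ek] : exists k, (K - i)%N = k.+1 by exists (K - i).-1; rewrite prednK // subn_gt0.
  have wk : walking h k.+1 by apply: walkingW wK _; rewrite -ek leq_subr.
  by rewrite ek walkS // inR_mateK leave_scheme // wk.
by rewrite wE // subnn inR_mateK.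
Qed.

Lemma scheme_mate_out h : ~~ is_stem r h -> in_scheme r h ->
  (scheme_mate r h \in out r) = (h \notin out r).
Proof.
move=> nh sh; have [K [wK sK]] := walk_end nh sh.
by rewrite (scheme_mate_walk wK sK) walk_out.
Qed.

Definition letter_of h : letter :=
  (inord (exit h).-1,
   if exit h == 1%N then rot r (rot r h) \in out r else rot r h \in out r).

Lemma lv_letter_of h : lv (letter_of h) = exit h.
Proof.
have := exit_bounds h; rewrite /lv /letter_of /= => b.
by rewrite inordK; lia.
Qed.

(** A letter records the direction of the first stem only. As [h] comes in and [leave h] goes out,
    the balance at the vertex forces the second stem to have the opposite direction. *)
Lemma letter_out_of h j : ~~ is_stem r h -> ~~ in_scheme r h -> h \notin out r ->
  (j < 4)%N -> letter_out (letter_of h) j = (iter j (rot r) h \in out r).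
Proof.
move=> nh ph oh ltj; rewrite /letter_out lv_letter_of /letter_of /=.
have := leave_out nh ph; have := updown_vertex h; rewrite /leave oh (negbTE oh).
have := exit_bounds h; case: (exit h) => [|[|[|[|k]]]] //= _.
all: case: j ltj => [|[|[|[|j]]]] //= _; rewrite ?(negbTE oh) //.
all: case: (rot r h \in out r) => //; case: (rot r (rot r h) \in out r) => //.
all: case: (rot r (rot r (rot r h)) \in out r) => //.
Qed.

End Walks.

Section Analysis.
Variables (S H : finType) (s : bmap S) (r : bmap H) (f : {ffun S -> H}).
Hypotheses (rR : inR r) (emb : scheme_embedding s r f).

Let d4 := inR_degree rR.

Lemma emb_inj : injective f.
Proof. by have /and5P[/injectiveP] := emb. Qed.

Lemma emb_codom h : (h \in codom f) = in_scheme r h.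
Proof. by have /and5P[_ /forallP/(_ h)/eqP] := emb. Qed.

Lemma emb_rot x : f (rot s x) = rot r (f x).
Proof. by have /and5P[_ _ /forallP/(_ x)/eqP] := emb. Qed.

Lemma emb_mate x : f (mate s x) = scheme_mate r (f x).
Proof. by have /and5P[_ _ _ /forallP/(_ x)/eqP] := emb. Qed.

Lemma emb_out x : (x \in out s) = (f x \in out r).
Proof. by have /and5P[_ _ _ _ /andP[/forallP/(_ x)/eqP]] := emb. Qed.

Lemma emb_root : f (root s) = root r.
Proof. by have /and5P[_ _ _ _ /andP[_ /eqP]] := emb. Qed.

Lemma emb_scheme x : in_scheme r (f x).
Proof. by rewrite -emb_codom codom_f. Qed.

Lemma emb_stem x : is_stem s x = is_stem r (f x).
Proof.
rewrite {1}/is_stem -(inj_eq emb_inj) emb_mate.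
have [st|nh] := boolP (is_stem r (f x)).
  by rewrite scheme_mate_stem ?emb_scheme ?eqxx.
apply/negbTE; apply: contraTneq isT => e.
by have := scheme_mate_out rR nh (emb_scheme x); rewrite e; case: (_ \in _).
Qed.

Lemma emb_mateK x : mate s (mate s x) = x.
Proof. by apply: emb_inj; rewrite !emb_mate scheme_mateK // emb_scheme. Qed.

Lemma emb_mate_out x : ~~ is_stem s x -> (mate s x \in out s) = (x \notin out s).
Proof.
by rewrite emb_stem !emb_out emb_mate => nh; rewrite scheme_mate_out ?emb_scheme.
Qed.

Lemma emb_iter i x : f (iter i (rot s) x) = iter i (rot r) (f x).
Proof. by elim: i => //= i IHi; rewrite emb_rot IHi. Qed.

Lemma emb_degree x : degree s x = 4.
Proof.
apply: card_porbit4; last by apply: emb_inj; rewrite emb_iter /= rot4.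
by rewrite -(map_inj_uniq emb_inj) /= !emb_rot; exact: (rot4_uniq d4 (f x)).
Qed.

Lemma emb_in_scheme x : in_scheme s x.
Proof.
have := emb_scheme x; rewrite /in_scheme (interior_degree4 d4).
by rewrite (interior_degree4 emb_degree) !emb_stem !emb_rot.
Qed.

Let mK := emb_mateK.
Let mo := emb_mate_out.

Lemma emb_expansion : exists (w : S -> seq letter) (e : raw S -> H),
  [/\ expansion s w r e, forall x, e (inl x) = f x
    & forall x, x \notin edges s -> w x = [::]].
Proof.
have nE x : x \in edges s -> ~~ is_stem r (f x).
  by rewrite inE emb_stem => /andP[].
have oE x : x \in edges s -> f x \in out r by rewrite inE emb_out => /andP[].
have [K KP] : exists K : S -> nat, forall x, x \in edges s ->
    walking r (f x) (K x) /\ in_scheme r (walk r (f x) (K x)).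
  apply: (@fin_all_exists _ (fun=> nat) (fun x k => x \in edges s ->
    walking r (f x) k /\ in_scheme r (walk r (f x) k))) => x.
  have [xE|_] := boolP (x \in edges s); last by exists 0%N.
  by have [k hk] := walk_end rR (nE _ xE) (emb_scheme x); exists k.
pose w x := if x \in edges s
  then [seq letter_of r (walk r (f x) i) | i <- iota 0 (K x)] else [::].
pose e (p : raw S) := match p with inl x => f x
  | inr (x, i, j) => iter j (rot r) (walk r (f x) i) end.
have sizew x : x \in edges s -> size (w x) = K x.
  by move=> xE; rewrite /w xE size_map size_iota.
have nthw x i : x \in edges s -> (i < K x)%N ->
    nth letter0 (w x) i = letter_of r (walk r (f x) i).
  move=> xE lti; rewrite /w xE (nth_map 0%N) ?size_iota //.
  by rewrite nth_iota.
have pE x i : x \in edges s -> (i < K x)%N -> ~~ in_scheme r (walk r (f x) i).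
  by move=> xE; have [wK _] := KP _ xE; exact: wK.
have wnE x i : x \in edges s -> (i <= K x)%N -> ~~ is_stem r (walk r (f x) i).
  move=> xE lei; have [wK _] := KP _ xE.
  exact: (walk_stem rR (nE _ xE) (walkingW wK lei)).
have woE x i : x \in edges s -> (i <= K x)%N -> walk r (f x) i \notin out r.
  move=> xE lei; have [wK _] := KP _ xE.
  by rewrite (walk_out rR (nE _ xE) (walkingW wK lei)) negbK oE.
have lvE x i : x \in edges s -> (i < K x)%N -> lvl w x i = exit r (walk r (f x) i).
  by move=> xE lti; rewrite /lvl nthw // lv_letter_of.
have efwd x i : x \in edges s -> (i <= K x)%N -> e (fwd s w x i) = walk r (f x) i.
  move=> xE; rewrite leq_eqVlt /fwd sizew // => /predU1P[->|-> //].
  have [wK sK] := KP _ xE.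
  by rewrite ltnn /= emb_mate (scheme_mate_walk wK sK).
have ebwd x i : x \in edges s -> (i <= K x)%N ->
    mate r (e (bwd w x i)) = e (fwd s w x i).
  move=> xE lei; rewrite efwd //; case: i lei => [//|i] lti.
  have [wK _] := KP _ xE.
  rewrite (walkS rR (nE _ xE) (walkingW wK lti)) /bwd /leave -lvE //.
have emate p : valid s w p -> mate r (e p) = e (rawmate s w p).
  move=> vp; have [x i xE lei ->|x i xE lei ->|st] := rawP mK mo vp.
  - by rewrite (rawmate_fwd mK mo) // -ebwd -?sizew // inR_mateK.
  - by rewrite rawmate_bwd // ebwd -?sizew.
  case: p vp st => [x|[[x i] j]] vp st.
    have : is_stem s x by rewrite -(rawmate_inl s w) st eqxx.
    by rewrite st emb_stem => /eqP.
  have /and3P[xE lti ltj] := vp; rewrite sizew // in lti.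
  have : (j != 0%N) && (j != lvl w x i) by rewrite -(rawmate_inr s) // st eqxx.
  rewrite st lvE // => /andP[j0 jl]; apply/eqP; rewrite -[_ == _]/(is_stem r _).
  rewrite -[is_stem _ _]negbK /= (exitP rR) ?wnE ?pE ?(ltnW lti) //.
  by rewrite lt0n j0.
have erot p : valid s w p -> rot r (e p) = e (rawrot s p).
  case: p => [x _|[[x i] j] /and3P[_ _ ltj]] /=; first by rewrite emb_rot.
  by case: j ltj => [|[|[|[|]]]] //= _; rewrite (rot4 d4).
have scE p : valid s w p -> in_scheme r (e p) = if p is inl _ then true else false.
  case: p => [x _|[[x i] j] /and3P[xE lti _]]; first exact: emb_scheme.
  by rewrite /e in_scheme_iter // (negbTE (pE _ _ _ _)) -?sizew.
exists w, e; split=> //; last by move=> x nx; rewrite /w (negbTE nx).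
split=> //.
- move=> p q vp vq epq; have := scE _ vp; rewrite epq scE //.
  case: p vp epq => [x _|[[x i] j]]; case: q vq => [x' _|[[x' i'] j']] //.
    by move=> /= /emb_inj->.
  move=> /and3P[xE' lti' ltj'] /and3P[xE lti ltj] eq _; rewrite !sizew // in lti lti'.
  set h := walk r (f x) i; set h' := walk r (f x') i'.
  (* If two walks entered the same vertex by different half-edges, one would enter where the other
     leaves, and this half-edge would be both ingoing and outgoing. *)
  have hh' : h = h'.
    have nh : ~~ is_stem r h by apply: wnE => //; exact: ltnW.
    have nh' : ~~ is_stem r h' by apply: wnE => //; exact: ltnW.
    have ph : ~~ in_scheme r h by exact: pE.
    have [k ltk ek] : exists2 k, (k < 4)%N & h' = iter k (rot r) h.
      have : h' \in porbit (rot r) h.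
        have mp k g : porbit (rot r) (iter k (rot r) g) = porbit (rot r) g.
          by apply/eqP; rewrite eq_porbit_mem -permX mem_porbit.
        have eq' : iter j (rot r) h = iter j' (rot r) h' by exact: eq.
        by rewrite -(mp j h) eq' mp porbit_id.
      by rewrite (porbit_traject4 d4) => /trajectP.
    have [k0|k0] := posnP k; first by rewrite ek k0.
    have kl : k == exit r h by rewrite -(exitP rR) ?k0 // -ek.
    have := leave_out rR nh ph; rewrite /leave -(eqP kl) -ek.
    by rewrite (negbTE (woE _ _ xE' (ltnW lti'))) woE // ltnW.
  have [wK _] := KP _ xE; have [wK' _] := KP _ xE'.
  have [/emb_inj ex ei] := walk_inj rR (nE _ xE) (nE _ xE') (emb_scheme _) (emb_scheme _)
     (walkingW wK (ltnW lti)) (walkingW wK' (ltnW lti')) hh'.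
  have /(rot_iter_inj d4 ltj ltj') -> : iter j (rot r) h = iter j' (rot r) h.
    by rewrite {2}hh'.
  by rewrite ex ei.
(* Surjectivity: the image of [e] contains the root and is stable under the contour, which visits
   every half-edge. *)
- apply: (unicellular_ind (inR_unicellular rR) (h0 := root r)).
    by exists (inl (root s)); rewrite //= emb_root.
  move=> _ [p vp <-]; have vr := valid_rot vp.
  exists (rawmate s w (rawrot s p)); first exact: valid_mate.
  by rewrite /contour erot // emate.
- move=> [x|[[x i] j]] vp; first by rewrite /= emb_out.
  have /and3P[xE lti ltj] := vp; rewrite sizew // in lti.
  by rewrite /rawout nthw // (letter_out_of rR) ?wnE ?pE ?woE // ltnW.
by rewrite /= emb_root.
Qed.

Lemma emb_good : good_scheme s.
Proof.
have [w [e [E _ _]]] := emb_expansion.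
have us : unicellular s by rewrite -(exp_unicellular mK mo E) inR_unicellular.
split=> //; first exact: emb_degree.
- exact: emb_in_scheme.
- rewrite -(exp_well_oriented mK mo E) //.
  by have /and5P[_ _ _ _ /and3P[]] := rR.
by rewrite /is_bud emb_stem emb_out emb_root; exact: (inR_root_bud rR).
Qed.

End Analysis.

(** * Maps and families of words *)

Lemma bool_eq_iff (a b : bool) : (a <-> b) -> a = b.
Proof. by move=> [ab ba]; apply/idP/idP. Qed.

Section Counting.
Variables (S : finType) (s : bmap S) (n : nat) (nu : vertex s -> 'I_n).
Variable pi : 'I_n -> vertex s.
Hypothesis gs : good_scheme s.

Lemma height_order_ext (l l' : S -> int) :
  l =1 l' -> height_order l nu pi = height_order l' nu pi.
Proof. by move=> /funext->. Qed.

Lemma RpiP (m k : nat) (r : bmap 'I_m) : r \in Rpi nu pi m k ->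
  exists (w : S -> seq letter) (e : raw S -> 'I_m),
  [/\ expansion s w r e, forall x, x \notin edges s -> w x = [::],
      labeling s w (fun x => label r (e (inl x))),
      height_order (fun x => label r (e (inl x))) nu pi
    & k = (n_leaves s + \sum_(x in edges s) size (w x))%N].
Proof.
rewrite inE => /and3P[rR /eqP <- /existsP[f /andP[emb ho]]].
have [w [e [E ef supp]]] := emb_expansion rR emb; exists w, e; split=> //.
- exact: (exp_labeling gs E (inR_well_labeled rR)).
- by rewrite (@height_order_ext _ (fun x => label r (f x))) // => x; rewrite ef.
- exact: (exp_n_leaves gs E).
Qed.

Lemma RpiI (m : nat) (r : bmap 'I_m) (w : S -> seq letter)
    (e : raw S -> 'I_m) l : expansion s w r e -> labeling s w l ->
  height_order l nu pi ->
  r \in Rpi nu pi m (n_leaves s + \sum_(x in edges s) size (w x)).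
Proof.
move=> E lab ho; rewrite inE (exp_inR gs E lab) (exp_n_leaves gs E) eqxx /=.
apply/existsP; exists [ffun x => e (inl x)]; rewrite (exp_embedding gs E) /=.
rewrite (@height_order_ext _ l) // => x.
by rewrite ffunE (exp_label_inl gs E x lab).
Qed.

Lemma Rpi_count0 k : (k < n_leaves s)%N -> Rpi_count nu pi k = 0%N.
Proof.
move=> ltk; rewrite /Rpi_count fsbig1 // => m _.
rewrite (_ : Rpi nu pi m k = finset.set0); first by rewrite /equivalence_partition imset0 cards0.
apply/setP => r; rewrite [RHS]inE; apply/negP => /RpiP[w [e [_ _ _ _ ek]]].
by move: ltk; rewrite ek ltnNge leq_addr.
Qed.

(** The total length [N] forces the number of half-edges, so the sum over [m] has a single relevant
    term. Sending a map to its words then separates isomorphism classes exactly, by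
    [expansion_unique] and [expansion_iso]. The bound [B] makes the families of words a finite type,
    and words are empty off [edges s] so that a family has no free values there. *)
Lemma Rpi_count_words (N B : nat) (W : {set {ffun S -> B.-bseq letter}}) :
  (N <= B)%N ->
  (forall w, w \in W <-> [/\ forall x, x \notin edges s -> w x = [::] :> seq letter,
      (\sum_(x in edges s) size (w x))%N = N
    & exists l, labeling s (fun x => w x) l /\ height_order l nu pi]) ->
  Rpi_count nu pi (n_leaves s + N) = #|W|.
Proof.
move=> leNB WP; pose m0 := (#|S| + 4 * N)%N.
have mE m r : r \in Rpi nu pi m (n_leaves s + N) -> m = m0.
  move=> /RpiP[w [e [E _ _ _ /eqP]]]; rewrite eqn_add2l => /eqP eN.
  by rewrite /m0 eN -(card_ord m) (exp_card E).
rewrite /Rpi_count -(@fsbig_widen _ _ _ _ [set m0]%classic) //; last first.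
  move=> m [_ ne] /=; rewrite (_ : Rpi _ _ m _ = finset.set0).
    by rewrite /equivalence_partition imset0 cards0.
  by apply/setP => r; rewrite [RHS]inE; apply/negP => /mE e; apply: ne.
rewrite fsbig_set1; set D := Rpi nu pi m0 _.
have [G GP] : exists G : bmap 'I_m0 -> {ffun S -> B.-bseq letter},
    forall r, r \in D -> exists e : raw S -> 'I_m0,
    expansion s (fun x => G r x) r e /\ G r \in W.
  apply: (@fin_all_exists _ (fun=> {ffun S -> B.-bseq letter})
    (fun r w => r \in D -> exists e : raw S -> 'I_m0,
       expansion s (fun x => w x) r e /\ w \in W)) => r.
  have [rD|_] := boolP (r \in D); last by exists [ffun=> [bseq]].
  have [w [e [E supp lab ho /eqP]]] := RpiP rD; rewrite eqn_add2l => /eqP eN.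
  have wB x : (size (w x) <= B)%N.
    have [xE|xE] := boolP (x \in edges s); last by rewrite supp.
    by apply: leq_trans leNB; rewrite eN (bigD1 x) //= leq_addr.
  pose w' := [ffun x => Bseq (wB x)].
  have ww' : (fun x => w' x : seq letter) = w by apply: funext => x; rewrite ffunE.
  exists w' => _; exists e; rewrite ww'; split=> //; apply/WP; split.
  - by move=> x /supp; rewrite ffunE.
  - by rewrite eN; apply: eq_bigr => x _; rewrite ffunE.
  - by exists (fun x => label r (e (inl x))); rewrite ww'.
have Geq (w w' : {ffun S -> B.-bseq letter}) : w \in W -> w' \in W ->
    {in edges s, (fun x => w x : seq letter) =1 (fun x => w' x)} -> w = w'.
  move=> /WP[sw _ _] /WP[sw' _ _] ww'; apply/ffunP => x; apply: val_inj.
  have [xE|xE] := boolP (x \in edges s); first exact: ww'.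
  by rewrite /= sw ?sw'.
have isoE : {in D &, forall r r', map_iso r r' = (G r == G r')}.
  move=> r r' rD r'D; have [e [E GW]] := GP _ rD; have [e' [E' GW']] := GP _ r'D.
  apply: bool_eq_iff; split=> [iso|/eqP eG].
    have [e'' E''] := iso_expansion E iso; apply/eqP/Geq => //.
    exact: (expansion_unique gs E'' E').
  by rewrite eG in E; exact: (expansion_iso gs E E').
transitivity #|G @: D|.
  have inD r r' : (r' \in [set y in D | map_iso r y]) = (r' \in D) && map_iso r r'.
    by rewrite inE.
  apply: card_imset_ker => r r' rD r'D; apply/eqP/eqP => [/setP/(_ r')|eG].
    by rewrite !inD r'D !isoE // eqxx => /eqP.
  apply/setP => r''; rewrite !inD; have [r''D|//] := boolP (r'' \in D).
  by rewrite !isoE // eG.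
apply: eq_card => w; apply/imsetP/idP => [[r rD ->]|wW].
  by have [e []] := GP _ rD.
have [sw wN [l [lab ho]]] := (WP w).1 wW.
have [r [e E]] : exists (r : bmap 'I_m0) (e : raw S -> 'I_m0),
    expansion s (fun x => w x) r e.
  by apply: (expansion_exists gs); rewrite size_rawlist wN.
have rD : r \in D by rewrite /D -wN; exact: (RpiI E lab ho).
exists r => //; have [e' [E' GW]] := GP _ rD; apply: Geq => //.
exact: (expansion_unique gs E E').
Qed.

End Counting.

(** * Power series in D *)

Definition eqX (N : nat) (p q : {poly rat}) : Prop :=
  forall i, (i < N)%N -> p`_i = q`_i.

Lemma eqXP N p q : eqX N p q <-> take_poly N p = take_poly N q.
Proof.
split=> [e|e i lti].
  by apply/polyP => i; rewrite !coef_take_poly; case: ifP => // /e.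
by have := congr1 (fun t : {poly rat} => t`_i) e; rewrite !coef_take_poly lti.
Qed.

Lemma eqX_refl N p : eqX N p p. Proof. by []. Qed.

Lemma eqX_sym N p q : eqX N p q -> eqX N q p.
Proof. by move=> e i lti; rewrite e. Qed.

Lemma eqX_trans N q p t : eqX N p q -> eqX N q t -> eqX N p t.
Proof. by move=> e e' i lti; rewrite e ?e'. Qed.

Lemma eqXW N M p q : (M <= N)%N -> eqX N p q -> eqX M p q.
Proof. by move=> le e i lti; apply: e; exact: leq_trans le. Qed.

Lemma eqXD N p q p' q' : eqX N p q -> eqX N p' q' -> eqX N (p + p') (q + q').
Proof. by move=> e e' i lti; rewrite !coefD e ?e'. Qed.

Lemma eqXN N p q : eqX N p q -> eqX N (- p) (- q).
Proof. by move=> e i lti; rewrite !coefN e. Qed.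

Lemma eqXM N p q p' q' : eqX N p q -> eqX N p' q' -> eqX N (p * p') (q * q').
Proof.
move=> e e' i lti; rewrite !coefM; apply: eq_bigr => j _.
have ltj := ltn_ord j.
rewrite e; last exact: leq_ltn_trans lti.
by rewrite e' // (leq_ltn_trans (leq_subr _ _)).
Qed.

Lemma eqX_exp N p q k : eqX N p q -> eqX N (p ^+ k) (q ^+ k).
Proof. by move=> e; elim: k => [|k IHk]; rewrite ?expr0 ?exprS //; exact: eqXM. Qed.

Lemma eqX_sum (I : Type) (r : seq I) (P : pred I) N (F G : I -> {poly rat}) :
  (forall i, P i -> eqX N (F i) (G i)) ->
  eqX N (\sum_(i <- r | P i) F i) (\sum_(i <- r | P i) G i).
Proof. by move=> e; apply: big_ind2 => // *; exact: eqXD. Qed.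

Lemma eqX_prod (I : Type) (r : seq I) (P : pred I) N (F G : I -> {poly rat}) :
  (forall i, P i -> eqX N (F i) (G i)) ->
  eqX N (\prod_(i <- r | P i) F i) (\prod_(i <- r | P i) G i).
Proof. by move=> e; apply: big_ind2 => // *; exact: eqXM. Qed.

Lemma eqXS N p q : eqX N p q -> eqX N.+1 ('X * p) ('X * q).
Proof. by move=> e [|i] lti; rewrite !coefXM //= e. Qed.

Lemma eqX_comp N (p D D' : {poly rat}) : eqX N D D' -> eqX N (p \Po D) (p \Po D').
Proof.
move=> e; rewrite !comp_polyE; apply: eqX_sum => i _ j ltj.
by rewrite !coefZ (eqX_exp i e).
Qed.

Lemma eqX0_exp N (D : {poly rat}) k : D`_0 = 0 -> (N <= k)%N -> eqX N (D ^+ k) 0.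
Proof.
move=> D0 leNk i lti; rewrite coef0.
suff h m : forall j, (j < m)%N -> (D ^+ m)`_j = 0 by apply: h; exact: leq_trans leNk.
elim: m => [|m IHm] j //; rewrite ltnS => lej; rewrite exprS coefM big1 // => l _.
have [l0|l0] := posnP l; first by rewrite l0 D0 mul0r.
by rewrite IHm ?mulr0 //; have := ltn_ord l; lia.
Qed.

Lemma eqX_cancel N (A Z : {poly rat}) : A`_0 != 0 -> eqX N (A * Z) 0 -> eqX N Z 0.
Proof.
move=> A0 e i; rewrite coef0; elim/ltn_ind: i => i IHi lti.
have := e i lti; rewrite coef0 coefM big_ord_recl subn0 big1 ?addr0.
  by move/eqP; rewrite mulf_eq0 (negbTE A0) => /eqP.
move=> j _; rewrite IHi ?mulr0 //=; have := ltn_ord j; rewrite /bump /=; lia.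
Qed.

Lemma eqX_truncation (a : nat -> rat) N M : (N <= M)%N ->
  eqX N (truncation a N) (truncation a M).
Proof.
by move=> le i lti; rewrite !coef_poly lti (leq_trans lti le).
Qed.

Definition Dpoly N := truncation Dseries N.

Lemma DpolyE N : eqX N (Dpoly N) ('X * (1 + 4%:R *: Dpoly N + Dpoly N ^+ 2)).
Proof.
apply/eqXP; rewrite -[in RHS]DseriesE take_poly_id // /Dpoly /truncation.
exact: size_poly.
Qed.

Lemma Dpoly0 N : (Dpoly N)`_0 = 0.
Proof.
have [->|N0] := posnP N; first by rewrite coef_poly.
by rewrite (@DpolyE N) // coefXM.
Qed.

Lemma Dpoly1 N : (1 < N)%N -> (Dpoly N)`_1 = 1.
Proof.
move=> N1; rewrite (@DpolyE N) // coefXM /= !coefD coefZ expr2 coefM big_ord1.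
by rewrite Dpoly0 !mulr0 !addr0 coef1.
Qed.

Section RationalInD.
Implicit Types (F : {fraction {poly rat}}) (P Q : {poly rat}).

Lemma frac_repr F : F = (\n_(repr F))%:F / (\d_(repr F))%:F.
Proof.
have d0 : (\d_(repr F))%:F != 0 by rewrite tofrac_eq0; exact: denom_ratioP.
apply: (mulIf d0); rewrite divfK // -{1}[F]reprK; set x := repr F.
have x0 := denom_ratioP x.
rewrite /GRing.mul /= !piE; apply/eqmodP; rewrite /= FracField.equivfE /FracField.mulf.
by rewrite !numden_Ratio ?oner_neq0 ?mulr1 ?mul1r // mulrC.
Qed.

(** [rational_in_D] speaks of the chosen representative p / q of the fraction, so one passes from P
    / Q to it through pQ = Pq and cancels Q(D). Since D = t (1 + ...), the series Q(D) is a power of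
    t times a series with nonzero constant term. *)
Lemma rational_in_D_frac (a : nat -> rat) P Q : Q != 0 ->
  (forall N, eqX N ((Q \Po Dpoly N) * truncation a N) (P \Po Dpoly N)) ->
  rational_in_D a (P%:F / Q%:F).
Proof.
move=> Q0 PQ N; set F := _ / _; apply/eqXP.
set p := \n_(repr F); set q := \d_(repr F).
have q0 : q != 0 by exact: denom_ratioP.
have pQ : p * Q = P * q.
  have := frac_repr F; rewrite -/p -/q /F => /eqP.
  rewrite eqr_div ?tofrac_eq0 // -!tofracM tofrac_eq => /eqP ->.
  by [].
have [v [U [U0 QE]]] : exists v (U : {poly rat}), U`_0 != 0 /\ Q = 'X^v * U.
  have [v [U]] := multiplicity_XsubC Q 0; rewrite Q0 /= subr0 => nr ->.
  by exists v, U; rewrite mulrC -horner_coef0.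
(* Cancelling X^v costs [v] orders of precision; the [+ 2] ensures that the coefficient 1 of X in
   [Dpoly M] is not truncated. *)
pose M := (N + v + 2)%N; pose D := Dpoly M; pose b := truncation a M.
suff : eqX N ((q \Po D) * b - (p \Po D)) 0.
  move=> e; have le : (N <= M)%N by rewrite /M; lia.
  have eD : eqX N (Dpoly N) D by exact: eqX_truncation.
  apply: (eqX_trans (eqXM (eqX_comp q eD) (eqX_truncation a le))).
  apply: (eqX_trans _ (eqX_sym (eqX_comp p eD))).
  by have := eqXD e (eqX_refl (p \Po D)); rewrite subrK add0r.
have [D1 [D10 DE]] : exists D1 : {poly rat}, D1`_0 = 1 /\ D = 'X * D1.
  exists (drop_poly 1 D); split.
    by rewrite coef_drop_poly Dpoly1 // /M; lia.
  rewrite -{1}(poly_take_drop 1 D) mulrC expr1 -[RHS]add0r; congr (_ + _).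
  apply/polyP => i; rewrite coef_take_poly coef0; case: ifP => //.
  by case: i => // _; exact: Dpoly0.
have eQ : Q \Po D = 'X^v * (D1 ^+ v * (U \Po D)).
  by rewrite QE comp_polyM comp_Xn_poly DE exprMn mulrA.
apply: (@eqX_cancel _ (D1 ^+ v * (U \Po D))).
  rewrite -horner_coef0 hornerM horner_exp horner_comp !horner_coef0 D10.
  by rewrite expr1n mul1r /D Dpoly0 horner_coef0.
move=> i lti; have /(_ (i + v)%N) : eqX M
    ('X^v * (D1 ^+ v * (U \Po D) * ((q \Po D) * b - (p \Po D)))) 0.
  rewrite mulrA -eQ mulrBr mulrCA -!comp_polyM [Q * p]mulrC pQ [P * q]mulrC.
  rewrite comp_polyM -mulrBr -[0](mulr0 (q \Po D)); apply: eqXM => //.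
  by have := eqXD (PQ M) (eqX_refl (- (P \Po D))); rewrite subrr.
rewrite !coef0 coefXnM addnK; have -> : (i + v < v)%N = false by lia.
by apply; rewrite /M; lia.
Qed.

End RationalInD.

(** * Substitution of 1/X in fractions *)

Definition Xinv : {fraction {poly rat}} := ('X%:F)^-1.
Definition ev_inv : {poly rat} -> {fraction {poly rat}} :=
  horner_eval Xinv \o map_poly (@FracField.tofrac _ \o polyC).
HB.instance Definition _ := GRing.RMorphism.on ev_inv.

Lemma ev_invX : ev_inv 'X = Xinv.
Proof. by rewrite /ev_inv /= map_polyX /horner_eval hornerX. Qed.

Lemma ev_inv_neq0 P : P != 0 -> ev_inv P != 0.
Proof.
move=> P0; pose n := size P.
have X0 : ('X : {poly rat})%:F != 0 by rewrite tofrac_eq0 polyX_eq0.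
have e : ev_inv P * 'X%:F ^+ n = (\sum_(i < n) P`_i *: 'X^(n - i))%:F.
  rewrite /ev_inv /= /horner_eval horner_coef size_map_poly mulr_suml rmorph_sum /=.
  apply: eq_bigr => i _; rewrite coef_map /= -mulrA -mul_polyC tofracM; congr (_ * _).
  have -> : ('X : {poly rat})%:F ^+ n = 'X%:F ^+ (n - i) * 'X%:F ^+ i.
    by rewrite -exprD subnK // ltnW.
  by rewrite tofracXn mulrCA -exprMn /Xinv (mulVf X0) expr1n mulr1.
suff : (\sum_(i < n) P`_i *: 'X^(n - i))%:F != 0.
  by rewrite -e; apply: contraNneq => ->; rewrite mul0r.
(* The multiplier is X^n with [n = size P], one more than the degree, so the leading coefficient of
   [P] appears as the coefficient of X and not as the constant term. *)
rewrite tofrac_eq0; apply: contraNneq P0 => /(congr1 (fun t : {poly rat} => t`_1)).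
rewrite coef0 coef_sum; have [k ek] : exists k, n = k.+1 \/ n = 0%N.
  by case: (n) => [|k]; [exists 0%N; right | exists k; left].
case: ek => ek; last by move=> _; rewrite -size_poly_leq0 -/n ek.
rewrite ek big_ord_recr /= big1 ?add0r; last first.
  move=> i _; rewrite coefZ coefXn; have := ltn_ord i.
  by case: eqP => [|_ _]; [lia | rewrite mulr0].
rewrite coefZ coefXn subSnn eqxx mulr1 => lc.
by rewrite -lead_coef_eq0 /lead_coef -/n ek lc.
Qed.

Lemma frac_eval_inv P Q : Q != 0 ->
  frac_eval (P%:F / Q%:F) ('X%:F)^-1 = ev_inv P / ev_inv Q.
Proof.
move=> Q0; set F := _ / _.
rewrite -[LHS]/(ev_inv \n_(repr F) / ev_inv \d_(repr F)).
have q0 : \d_(repr F) != 0 by exact: denom_ratioP.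
have e : \n_(repr F) * Q = P * \d_(repr F).
  have := frac_repr F; rewrite {1}/F => /eqP.
  by rewrite eqr_div ?tofrac_eq0 // -!tofracM tofrac_eq => /eqP.
by apply/eqP; rewrite eqr_div ?ev_inv_neq0 // -!rmorphM e.
Qed.

(** * Generating polynomials of words with a given displacement *)

Definition word_poly (B : nat) (d : int) : {poly rat} :=
  \sum_(a : B.-bseq letter) if wdisp a == d then 'X^(size a) else 0.

Lemma word_poly0 d : word_poly 0 d = if d == 0 then 1 else 0.
Proof.
rewrite /word_poly (bigD1 [bseq]) //= big1 ?addr0; last first.
  by move=> a; rewrite bseq0 eqxx.
by rewrite /wdisp big_nil eq_sym expr0.
Qed.

Lemma word_polyS B d : word_poly B.+1 d = (if d == 0 then 1 else 0) +
  'X * \sum_(c : letter) word_poly B (d - disp c).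
Proof.
rewrite {1}/word_poly (bigD1 [bseq]) //= /wdisp big_nil eq_sym expr0; congr (_ + _).
rewrite mulr_sumr /word_poly.
under [RHS]eq_bigr do rewrite mulr_sumr.
rewrite pair_big /= (reindex_onto (fun p : letter * B.-bseq letter => [bseq of p.1 :: p.2])
  (fun a : B.+1.-bseq letter => (head letter0 a, insub_bseq B (behead a)))) /=.
  apply: eq_big => [[c a]|[c a] _] /=.
    by rewrite /insub_bseq valKd eqxx.
  rewrite big_cons -/(wdisp a).
  have -> : (disp c + wdisp a == d) = (wdisp a == d - disp c) by apply/eqP/eqP; lia.
  by case: eqP => _; rewrite ?mulr0 // exprS.
move=> [[|c u] /= ltu] // _; apply: val_inj => /=.
by rewrite /insub_bseq val_insubd; move: ltu; rewrite ltnS => ->.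
Qed.

Lemma sum_disp (F : int -> {poly rat}) (d : int) :
  \sum_(c : letter) F (d - disp c) = F d *+ 4 + F (d - 1) + F (d + 1).
Proof.
rewrite -(pair_bigA _ (fun i b => F (d - disp (i, b)))) /=.
rewrite !big_ord_recl big_ord0 !big_bool /disp /= !subr0 opprK addr0.
ring.
Qed.

(** Words of length at most [B] give the right coefficients up to degree [B]. Prepending a letter
    multiplies by X, which gains the order of precision required by the induction. *)
Lemma word_polyE N B d : (B < N)%N ->
  eqX B.+1 ((1 - Dpoly N ^+ 2) * word_poly B d)
           ((1 + 4%:R *: Dpoly N + Dpoly N ^+ 2) * Dpoly N ^+ (absz d)).
Proof.
move=> ltBN; set D := Dpoly N.
have D0 : D`_0 = 0 by exact: Dpoly0.
(* The first-letter recurrence, with [D] in place of X (1 + 4D + D^2). For [e != 0] the two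
   neighbours have exponents k and k + 2; at [e = 0] both have exponent 1, and the term 1 - D^2
   makes up the difference. *)
have step (e : int) : (1 - D ^+ 2) * (if e == 0 then 1 else 0) +
    D * (D ^+ (absz e) *+ 4 + D ^+ (absz (e - 1)) + D ^+ (absz (e + 1)))
    = (1 + 4%:R *: D + D ^+ 2) * D ^+ (absz e).
  rewrite scaler_nat; have [->|e0] := eqVneq e 0.
    by rewrite !expr0 !expr1; ring.
  have [k ek] : exists k, e = k.+1%:Z \/ e = - k.+1%:Z.
    by exists (absz e).-1; lia.
  have [-> [[h h']|[h h']]] : absz e = k.+1 /\
     (absz (e - 1) = k /\ absz (e + 1) = k.+2 \/ absz (e - 1) = k.+2 /\ absz (e + 1) = k) by lia.
    by rewrite h h' !exprS; ring.
  by rewrite h h' !exprS; ring.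
elim: B d ltBN => [|B IHB] d ltBN.
  move=> [|//] _; rewrite word_poly0 -!horner_coef0 !hornerE /= !horner_coef0 D0.
  by case: d => [[|d]|d] /=; rewrite ?expr0n ?hornerE /= ?coef1 ?coef0.
rewrite word_polyS sum_disp mulrDr mulrCA -step.
apply: eqXD => //.
apply: (eqX_trans (q := 'X * ((1 + 4%:R *: D + D ^+ 2) *
   (D ^+ (absz d) *+ 4 + D ^+ (absz (d - 1)) + D ^+ (absz (d + 1)))))).
  apply: eqXS; rewrite !mulrDr.
  have h e := IHB e (ltnW ltBN).
  by do ![exact: h | apply: eqXD].
rewrite mulrA; apply: eqXM => //; apply: eqX_sym.
exact: (eqXW ltBN (@DpolyE N)).
Qed.

(** * Heights and gaps *)

Section RelativeLabels.
Variables (S : finType) (s : bmap S) (l0 : S -> int).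
Hypotheses (gs : good_scheme s).
Hypothesis l0_rot : forall x, l0 (rot s x) = l0 x + updown (rot s x \in out s).

Let d4 := good_degree gs.
Let mK := good_mateK gs.
Let mo := good_mate_out gs.

Lemma vertex_of_rot x : vertex_of s (rot s x) = vertex_of s x.
Proof. by apply: val_inj; rewrite /= -[rot s x]/((rot s ^+ 1)%g x) porbit_perm. Qed.

Lemma vertex_of_rot_inv x : vertex_of s (rot_inv s x) = vertex_of s x.
Proof. by rewrite -{2}(rot_invK s x) vertex_of_rot. Qed.

Lemma vertex_of_surj v : exists x, vertex_of s x = v.
Proof.
by have /imsetP[x _ e] := valP v; exists x; apply: val_inj; rewrite /= -e.
Qed.

Lemma heightP (l : S -> int) x : exists2 y, y \in porbit (rot s) x &
  height l (vertex_of s x) = l y /\ forall z, z \in porbit (rot s) x -> l y <= l z.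
Proof.
rewrite /height; case: pickP => [y /andP[yx /forallP ymin]|no] /=.
  by exists y => //; split=> // z zx; have /implyP := ymin z; apply.
have [y yx ymin] := @Order.TotalTheory.arg_minP _ _ _ x
  [in porbit (rot s) x] l (porbit_id _ _).
have /negP[] := negbT (no y); apply/andP; split=> //.
by apply/forallP => z; apply/implyP => /ymin.
Qed.

Notation rel := (relative_label s l0).

Lemma rel_rot x : rel (rot s x) = rel x + updown (rot s x \in out s).
Proof. by rewrite /relative_label vertex_of_rot l0_rot addrAC. Qed.

Lemma rel_rot_inv x : rel (rot_inv s x) = rel x - updown (x \in out s).
Proof. by rewrite -{2 3}(rot_invK s x) rel_rot addrK. Qed.

Lemma vertex_of_porbit x y : y \in porbit (rot s) x -> vertex_of s y = vertex_of s x.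
Proof. by rewrite -eq_porbit_mem => /eqP e; apply: val_inj. Qed.

Lemma rel_ge0 x : 0 <= rel x.
Proof.
have [y yx [e ymin]] := heightP l0 x.
by rewrite /relative_label e subr_ge0 ymin // porbit_id.
Qed.

Lemma rel_min x : exists2 y, y \in porbit (rot s) x & rel y = 0.
Proof.
have [y yx [e _]] := heightP l0 x; exists y => //.
by rewrite /relative_label (vertex_of_porbit yx) e subrr.
Qed.

(** Around a vertex of degree 4, every corner is at most two turns, in one direction or the other,
    from a corner of minimal label. *)
Lemma rel_le2 x : rel x <= 2.
Proof.
have [y yx y0] := rel_min x.
have : x \in porbit (rot s) y by rewrite porbit_sym.
have r1 := rel_rot y; have r2 := rel_rot (rot s y).
have r3 := rel_rot (rot s (rot s y)); have r4 := rel_rot (rot s (rot s (rot s y))).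
rewrite (rot4 d4) in r4.
have ud b : -1 <= updown b <= 1 by case: b.
rewrite (porbit_traject4 d4) !inE => /or4P[]/eqP->.
- lia.
- by have := ud (rot s y \in out s); lia.
- by have := ud (rot s y \in out s); have := ud (rot s (rot s y) \in out s); lia.
- by have := ud (y \in out s); lia.
Qed.

Lemma height_shift (l : S -> int) (h : vertex s -> int) :
  (forall x, l x = h (vertex_of s x) + rel x) -> forall v, height l v = h v.
Proof.
move=> lE v; have [x <-] := vertex_of_surj v.
have [y yx [-> ymin]] := heightP l x; have [z zx z0] := rel_min x.
have := ymin _ zx; rewrite !lE z0 (vertex_of_porbit yx) (vertex_of_porbit zx).
by have := rel_ge0 y; lia.
Qed.

Lemma rot_label_height (l : S -> int) :
  (forall x, l (rot s x) = l x + updown (rot s x \in out s)) ->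
  forall x, l x = height l (vertex_of s x) + rel x.
Proof.
move=> lr x.
have kE y : y \in porbit (rot s) x -> l y - rel y = l x - rel x.
  case/porbitP=> i ->; elim: i => [|i IHi]; first by rewrite expg0 perm1.
  by rewrite expgSr permM lr rel_rot -IHi opprD addrACA subrr addr0.
have [y yx [-> ymin]] := heightP l x; have [z zx z0] := rel_min x.
have := ymin _ zx; have := kE _ yx; have := kE _ zx; rewrite z0.
by have := rel_ge0 y; lia.
Qed.

(** Connectedness of the scheme, in the form of an induction along its contour. An edge may be
    traversed in either direction, which is why an equivalence is required on edges. *)
Lemma scheme_const (P : S -> Prop) x0 : P x0 ->
  (forall x, P x -> P (rot s x)) ->
  (forall x, x \in edges s -> P x <-> P (mate s x)) -> forall x, P x.
Proof.
move=> P0 Pr Pm; apply: (unicellular_ind (good_unicellular gs) P0) => x Px.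
rewrite /contour; move: (rot s x) (Pr _ Px) => {Px}y Py.
have [/eqP->//|ny] := boolP (is_stem s y).
have [oy|oy] := boolP (y \in out s); first by apply: (proj1 (Pm y _)) => //; rewrite inE ny.
by apply: (proj2 (Pm _ (edges_mate mK mo ny oy))); rewrite mK.
Qed.

(** * Height orders encoded by the gaps between consecutive heights *)

Section Gaps.
Variables (n : nat) (nu : vertex s -> 'I_n.+1) (pi : 'I_n.+1 -> vertex s).
Variable rk : vertex s -> 'I_n.+1.
Hypotheses (rkK : cancel rk pi) (piK : cancel pi rk).
Hypothesis nu_inj : injective nu.
Hypothesis hcons : forall u v, offset_toward l0 u v -> (nu u < nu v)%N.

Definition below (j : 'I_n) : 'I_n.+1 := widen_ord (leqnSn n) j.
Definition above (j : 'I_n) : 'I_n.+1 := lift ord0 j.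
Definition desc (j : 'I_n) : bool := (nu (pi (above j)) < nu (pi (below j)))%N.

Implicit Types (g : 'I_n -> nat) (x y : S) (j : 'I_n).

Definition gapok g := forall j, (desc j <= g j)%N.

Definition gapsum g (a b : nat) : int := \sum_(j < n | (a <= j < b)%N) (g j)%:Z.
Definition gap_height g v : int := gapsum g 0 (rk v).
(** The subtracted constant gives the root corner the label 0, as in the canonical labeling. *)
Definition gap_label g x : int := gap_height g (vertex_of s x) + rel x
  - (gap_height g (vertex_of s (root_corner s)) + rel (root_corner s)).
Definition edge_disp g x : int :=
  gap_height g (vertex_of s (mate s x)) + rel (mate s x)
  - (gap_height g (vertex_of s x) + rel (rot_inv s x)).

Lemma gapsum_cat g a b c : (a <= b)%N -> (b <= c)%N ->
  gapsum g a c = gapsum g a b + gapsum g b c.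
Proof.
move=> ab bc; rewrite /gapsum (bigID (fun j : 'I_n => (j < b)%N)) /=; congr (_ + _).
  by apply: eq_bigl => j; lia.
by apply: eq_bigl => j; lia.
Qed.

Lemma gapsum_ge0 g a b : 0 <= gapsum g a b.
Proof. by apply: sumr_ge0 => j _; lia. Qed.

Lemma gapsum1 g j : gapsum g j j.+1 = g j.
Proof.
rewrite /gapsum (big_pred1 j) // => k.
by rewrite ltnS -eqn_leq eq_sym.
Qed.

Lemma gap_height_step g j :
  gap_height g (pi (above j)) = gap_height g (pi (below j)) + (g j)%:Z.
Proof.
by rewrite /gap_height !piK /= /bump leq0n add1n (gapsum_cat g (leq0n j) (leqnSn j)) gapsum1.
Qed.

Lemma eq_edge_disp g g' : g =1 g' -> edge_disp g =1 edge_disp g'.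
Proof.
move=> e x; have hE v : gap_height g v = gap_height g' v.
  by apply: eq_bigr => j _; rewrite e.
by rewrite /edge_disp !hE.
Qed.

Lemma gap_labeling g (w : S -> seq letter) :
  labeling s w (gap_label g) <-> {in edges s, forall x, wdisp (w x) = edge_disp g x}.
Proof.
split=> [[_ _ lm] x xE|h].
  by have := lm x xE; rewrite /gap_label /edge_disp vertex_of_rot_inv; lia.
split.
- by rewrite /gap_label subrr.
- by move=> x; rewrite /gap_label vertex_of_rot rel_rot; lia.
by move=> x xE; rewrite h // /gap_label /edge_disp vertex_of_rot_inv; lia.
Qed.

Lemma gap_heightE g v : height (gap_label g) v = gap_height g v
  - (gap_height g (vertex_of s (root_corner s)) + rel (root_corner s)).
Proof.
move: v; apply: (@height_shift _ (fun v => gap_height g v - _)) => x.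
by rewrite /gap_label; lia.
Qed.

(** Reduces statements about the height order to neighbouring ranks, where they concern a single
    gap. *)
Lemma ord_consecutive_ind (P : 'I_n.+1 -> 'I_n.+1 -> Prop) :
  (forall j, P (below j) (above j)) ->
  (forall a b c : 'I_n.+1, (a < b)%N -> (b < c)%N -> P a b -> P b c -> P a c) ->
  forall a b : 'I_n.+1, (a < b)%N -> P a b.
Proof.
move=> P1 Pt a [b ltb] /=; elim: b ltb => [//|b IHb] ltb.
have ltbn : (b < n)%N by [].
have eb : below (Ordinal ltbn) = Ordinal (ltnW ltb) by exact: val_inj.
have ea : above (Ordinal ltbn) = Ordinal ltb by apply: val_inj; rewrite /= /bump.
rewrite ltnS leq_eqVlt => /predU1P[e|lt].
  have -> : a = below (Ordinal ltbn) by exact: val_inj.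
  by rewrite -ea.
apply: (Pt _ (Ordinal (ltnW ltb))) => //; first exact: IHb.
by rewrite -eb -ea.
Qed.

Lemma gapok_order g : gapok g -> height_order (gap_label g) nu pi.
Proof.
move=> ok; apply/forallP => a; apply/forallP => b; apply/implyP.
move: a b; apply: ord_consecutive_ind => [j|a b c _ _].
  have := ok j; rewrite !gap_heightE gap_height_step /desc.
  have [lt|le] := ltnP (nu (pi (above j))) _; first by lia.
  have : nu (pi (below j)) != nu (pi (above j)).
    rewrite (inj_eq nu_inj) (inj_eq (can_inj piK)) -val_eqE /= /bump /=; lia.
  rewrite -val_eqE /=; lia.
lia.
Qed.

Lemma order_gapok (l : S -> int) : height_order l nu pi ->
  let g j := absz (height l (pi (above j)) - height l (pi (below j))) in
  gapok g /\ forall v, gap_height g v = height l v - height l (pi ord0).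
Proof.
move=> /forallP ho g.
have hoj j : (height l (pi (below j)) < height l (pi (above j)))
   || ((height l (pi (below j)) == height l (pi (above j)))
       && (nu (pi (below j)) < nu (pi (above j)))%N).
  by have /forallP/(_ (above j))/implyP := ho (below j); apply.
split=> [j|v]; first by have := hoj j; rewrite /desc /g; lia.
rewrite -{2}(rkK v) -{1}(rkK v); move: (rk v) => {v} -[b ltb].
elim: b ltb => [|b IHb] ltb.
  have -> : Ordinal ltb = ord0 by exact: val_inj.
  by rewrite /gap_height piK /gapsum big1 ?subrr // => j; rewrite ltn0 andbF.
have ltbn : (b < n)%N by [].
have eb : below (Ordinal ltbn) = Ordinal (ltnW ltb) by exact: val_inj.
have <- : above (Ordinal ltbn) = Ordinal ltb by apply: val_inj; rewrite /= /bump.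
by rewrite gap_height_step eb IHb -eb; have := hoj (Ordinal ltbn); rewrite /g; lia.
Qed.

Lemma labeling_gap (w : S -> seq letter) (l : S -> int) :
  labeling s w l -> height_order l nu pi ->
  exists2 g, gapok g & {in edges s, forall x, wdisp (w x) = edge_disp g x}.
Proof.
move=> [lc lr lm] /order_gapok[ok gE].
eexists; first exact: ok.
move=> x xE; rewrite /edge_disp !gE.
have lE := rot_label_height lr; have := lm _ xE.
rewrite (lE (mate s x)) (lE (rot_inv s x)) vertex_of_rot_inv; lia.
Qed.

Definition between x j : bool :=
  (minn (rk (vertex_of s x)) (rk (vertex_of s (mate s x))) <= j <
   maxn (rk (vertex_of s x)) (rk (vertex_of s (mate s x))))%N.
(** The part of the absolute displacement that does not depend on the gaps: the relative label at
    the end of higher rank minus the one at the end of lower rank. For a loop both are equal, as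
    [edge_types] shows. *)
Definition offset x : int :=
  if (rk (vertex_of s x) < rk (vertex_of s (mate s x)))%N
    then rel (mate s x) - rel (rot_inv s x)
  else if (rk (vertex_of s (mate s x)) < rk (vertex_of s x))%N
    then rel (rot_inv s x) - rel (mate s x) else 0.

(** If the naming decreases between two ranks, it decreases at some consecutive pair in between, and
    the gap there is at least 1. *)
Lemma gapsum_desc g (u v : vertex s) : gapok g -> (rk u < rk v)%N ->
  (nu v < nu u)%N -> 1 <= gapsum g (rk u) (rk v).
Proof.
move=> ok; rewrite -{2}(rkK u) -{2}(rkK v); move: (rk u) (rk v).
apply: ord_consecutive_ind => [j|a b c ltab ltbc hab hbc] h.
  by have := ok j; rewrite /desc h /= /bump add1n gapsum1; lia.
rewrite (gapsum_cat g (ltnW ltab) (ltnW ltbc)).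
have := gapsum_ge0 g a b; have := gapsum_ge0 g b c.
have [lt|ge] := ltnP (nu (pi b)) (nu (pi a)); first by have := hab lt; lia.
by have := hbc (leq_trans h ge); lia.
Qed.

(** At both ends the corner on the left of the edge has relative label one more than the corner on
    the right, and at most 2. So the relative label on the right is 0 or 1 and is the type of the
    half-edge; the last two clauses are then consistency. *)
Lemma edge_types x : x \in edges s -> [/\ 0 <= rel (rot_inv s x) <= 1,
  0 <= rel (mate s x) <= 1,
  rel (rot_inv s x) = 0 -> rel (mate s x) = 1 ->
    (nu (vertex_of s x) < nu (vertex_of s (mate s x)))%N
  & rel (rot_inv s x) = 1 -> rel (mate s x) = 0 ->
    (nu (vertex_of s (mate s x)) < nu (vertex_of s x))%N].
Proof.
move=> xE; have ox := edges_out xE; have oy := edges_mate_out mo xE.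
have nx := negbT (edges_stem xE).
have rx := rel_rot_inv x; rewrite ox /= in rx.
have ry := rel_rot_inv (mate s x); rewrite oy /= in ry.
have gx := rel_le2 x; have gy := rel_le2 (rot_inv s (mate s x)).
have lx := rel_ge0 (rot_inv s x); have ly := rel_ge0 (mate s x).
split; [lia | lia | |] => tx ty; apply: hcons.
  exists x; split=> //.
    by rewrite /half_edge_type tx (_ : rel x = 1) //; lia.
  by rewrite /half_edge_type ty (_ : rel (rot_inv s (mate s x)) = 2) //; lia.
exists (mate s x); rewrite mK; split=> //; first by rewrite is_stem_mate.
  by rewrite /half_edge_type ty (_ : rel (rot_inv s (mate s x)) = 1) //; lia.
by rewrite /half_edge_type tx (_ : rel x = 2) //; lia.
Qed.

(** Taken from the lower rank to the higher one, the displacement is the sum of the gaps plus an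
    offset of at least -1. An offset of -1 means that the edge is offset toward its end of lower
    rank, and [gapsum_desc] then makes the sum of the gaps at least 1. *)
Lemma edge_disp_abs g x : gapok g -> x \in edges s ->
  (absz (edge_disp g x))%:Z = \sum_(j < n) (between x j * g j)%N%:Z + offset x.
Proof.
move=> ok xE; have [tx ty t01 t10] := edge_types xE.
have -> : \sum_(j < n) (between x j * g j)%N%:Z =
    gapsum g (minn (rk (vertex_of s x)) (rk (vertex_of s (mate s x))))
             (maxn (rk (vertex_of s x)) (rk (vertex_of s (mate s x)))).
  rewrite /gapsum [RHS]big_mkcond; apply: eq_bigr => j _.
  by rewrite -/(between x j); case: (between x j); rewrite ?mul1n ?mul0n.
rewrite /offset /edge_disp /gap_height.
move: t01 t10; set u := vertex_of s x; set v := vertex_of s (mate s x) => t01 t10.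
have [lt|lt|e] := ltngtP (rk u) (rk v).
- have := @gapsum_desc g u v ok lt; have := gapsum_ge0 g (rk u) (rk v).
  by rewrite (gapsum_cat g (leq0n _) (ltnW lt)); lia.
- have := @gapsum_desc g v u ok lt; have := gapsum_ge0 g (rk v) (rk u).
  by rewrite (gapsum_cat g (leq0n _) (ltnW lt)); lia.
have uv : u = v by apply: (can_inj rkK); exact: val_inj.
rewrite -uv in t01 t10 *.
have -> : gapsum g (rk u) (rk u) = 0 by rewrite /gapsum big_pred0 // => j; lia.
by lia.
Qed.

Definition crossing j : nat := (\sum_(x in edges s) between x j)%N.
Definition total_offset : int := \sum_(x in edges s) offset x.
Definition total_disp g : nat := (\sum_(x in edges s) absz (edge_disp g x))%N.

Lemma total_dispE g : gapok g ->
  (total_disp g)%:Z = \sum_(j < n) (crossing j * g j)%N%:Z + total_offset.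
Proof.
move=> ok; rewrite /total_disp -natz natr_sum.
under eq_bigr => x xE do rewrite natz (edge_disp_abs ok xE).
rewrite big_split exchange_big /=; congr (_ + _); apply: eq_bigr => j _.
rewrite /crossing big_distrl /= -[RHS]natz natr_sum.
by apply: eq_bigr => x _; rewrite natz.
Qed.

(** If no edge crossed the gap, the vertices of rank at most [j] would be disconnected from the
    others. *)
Lemma crossing_gt0 j : (0 < crossing j)%N.
Proof.
rewrite lt0n; apply/negP; rewrite sum_nat_eq0 => /forall_inP h.
have nb x : x \in edges s -> between x j = false.
  by move=> /h; case: (between x j).
have [a ea] := vertex_of_surj (pi (below j)); have [b eb] := vertex_of_surj (pi (above j)).
have all_below : forall x, (rk (vertex_of s x) <= j)%N.
  apply: (@scheme_const _ a) => [|x|x xE]; first by rewrite ea piK.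
    by rewrite vertex_of_rot.
  by have := nb _ xE; rewrite /between; split; lia.
by have := all_below b; rewrite eb piK /= /bump; lia.
Qed.

Lemma gap_unique g g' : {in edges s, edge_disp g =1 edge_disp g'} -> g =1 g'.
Proof.
move=> e; have [a ea] := vertex_of_surj (pi ord0).
have dE : forall x, gap_height g (vertex_of s x) - gap_height g' (vertex_of s x) =
   gap_height g (pi ord0) - gap_height g' (pi ord0).
  apply: (@scheme_const _ a); rewrite ?ea // => x; first by rewrite vertex_of_rot.
  move=> /e; rewrite /edge_disp => h; split; lia.
move=> j; have [x ex] := vertex_of_surj (pi (below j)).
have [y ey] := vertex_of_surj (pi (above j)).
have := dE x; have := dE y; rewrite ex ey !gap_height_step; lia.
Qed.

(** Some edge crosses the gap, and its offset is at least -1; this accounts for the extra 1. *)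
Lemma gap_bound g j M : gapok g ->
  {in edges s, forall x, (absz (edge_disp g x) <= M)%N} -> (g j <= M.+1)%N.
Proof.
move=> ok hM; have := crossing_gt0 j.
rewrite lt0n sum_nat_eq0 negb_forall_in => /exists_inP[x xE].
rewrite eqb0 negbK => bx; have := hM _ xE.
have := edge_disp_abs ok xE; rewrite (bigD1 j) //= bx mul1n.
have := edge_types xE; rewrite /offset => -[tx ty _ _].
set t := \sum_(_ < _ | _) _.
have : 0 <= t by apply: sumr_ge0 => k _; lia.
by case: ifP => _; [|case: ifP => _]; lia.
Qed.

End Gaps.
End RelativeLabels.

(** * The generating series *)

(* Euler's formula modulo 2: compare the signatures in [contour = mate o rot],
   the contour being a single cycle. *)
Lemma scheme_parity (S : finType) (s : bmap S) : good_scheme s ->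
  odd (#|edges s| + #|vertex s|).
Proof.
move=> gs; have mK := good_mateK gs; have mo := good_mate_out gs.
have cE x : ((rot s * mate s)%g : {perm S}) x = contour s x by rewrite permM.
have c1 : #|porbits (rot s * mate s)%g| = 1%N.
  have -> : porbits (rot s * mate s)%g = [set setT]; last by rewrite cards1.
  have porbitT x : porbit (rot s * mate s)%g x = setT.
    apply/setP => y; rewrite [RHS]inE.
    have /forallP/(_ x)/forallP/(_ y)/iter_findex <- := good_unicellular gs.
    rewrite -(eq_iter cE) -permX; exact: mem_porbit.
  apply/setP => A; rewrite inE; apply/imsetP/eqP => [[x _ ->] //|->].
  by exists (root s).
pose Y := [set mate s x | x in edges s].
have YE : #|Y| = #|edges s| by apply: card_imset; exact: perm_inj.
have mP x y : y \in porbit (mate s) x -> y = x \/ y = mate s x.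
  case/porbitP=> i ->; elim: i => [|i [IHi|IHi]]; first by rewrite expg0 perm1; left.
    by rewrite expgSr permM IHi; right.
  by rewrite expgSr permM IHi mK; left.
(* Each orbit of [mate s] has exactly one element outside [Y]: the stem itself, or the outgoing half
   of the edge. *)
have P1 : #|porbits (mate s)| = #|~: Y|.
  rewrite -(card_in_imset (f := porbit (mate s)) (D := ~: Y)).
    apply: eq_card => A; apply/imsetP/imsetP => [[x _ ->]|[x _ ->]]; last by exists x.
    have [/imsetP[y yE ->]|xY] := boolP (x \in Y); last by exists x; rewrite ?inE.
    exists y; last by apply/eqP; rewrite eq_porbit_mem; exact: (mem_porbit _ 1).
    rewrite inE; apply/imsetP => -[z zE ez].
    by have := edges_mate_out mo zE; rewrite -ez (edges_out yE).
  move=> x y; rewrite !inE => xY yY e.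
  have : y \in porbit (mate s) x by rewrite e porbit_id.
  case/mP=> // ey; have [/eqP sx|nx] := boolP (is_stem s x); first by rewrite ey sx.
  have [ox|ox] := boolP (x \in out s).
    by case/negP: yY; rewrite ey; apply: imset_f; rewrite inE nx.
  by case/negP: xY; rewrite -(mK x); apply: imset_f; exact: edges_mate.
have := odd_permM (rot s) (mate s); rewrite /odd_perm c1 P1.
have -> : #|vertex s| = #|porbits (rot s)| by rewrite card_sig.
have := cardsC Y; rewrite YE oddD => <-; rewrite oddD.
by case: (odd #|edges s|); case: (odd #|~: Y|); case: (odd #|porbits (rot s)|).
Qed.

Lemma wdisp_size (u : seq letter) : (absz (wdisp u) <= size u)%N.
Proof.
elim: u => [|a u IHu]; first by rewrite /wdisp big_nil.
have : (absz (disp a) <= 1)%N by rewrite /disp; do 2?case: ifP.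
by rewrite /wdisp big_cons -/(wdisp u) /=; lia.
Qed.

(* [D = t * kappa D] *)
Definition kappa (D : {poly rat}) : {poly rat} := 1 + 4%:R *: D + D ^+ 2.

Section Series.
Variables (S : finType) (s : bmap S) (l0 : S -> int).
Hypotheses (gs : good_scheme s).
Hypothesis l0_rot : forall x, l0 (rot s x) = l0 x + updown (rot s x \in out s).
Variables (n : nat) (nu : vertex s -> 'I_n.+1) (pi : 'I_n.+1 -> vertex s).
Variable rk : vertex s -> 'I_n.+1.
Hypotheses (rkK : cancel rk pi) (piK : cancel pi rk).
Hypothesis nu_inj : injective nu.
Hypothesis hcons : forall u v, offset_toward l0 u v -> (nu u < nu v)%N.

Local Notation desc := (desc nu pi).
Local Notation edge_disp := (edge_disp l0 rk).
Local Notation crossing := (crossing rk).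
Local Notation total_disp := (total_disp l0 rk).

Section Words.
Variable B : nat.

(** By [gap_bound], words of total length at most [B] only need gaps up to [B + 1]. *)
Let gaps := {ffun 'I_n -> 'I_B.+2}.
Let words := {ffun S -> B.-bseq letter}.
Implicit Types (g : gaps) (w : words).

Definition gap_ok g : bool := [forall j, desc j <= g j]%N.
(** Prescribing the empty word off [edges s] turns products over edges into products over all
    half-edges, where sums of products can be expanded over families. *)
Definition fits1 (g : gaps) (x : S) (a : B.-bseq letter) : bool :=
  if x \in edges s then wdisp a == edge_disp (fun j => g j) x else a == [bseq].
Definition fits g w : bool := [forall x, fits1 g x (w x)].
Definition word_size w : nat := (\sum_(x in edges s) size (w x))%N.
Definition gap_words (N : nat) : {set words} :=
  [set w | (word_size w == N) && [exists g, gap_ok g && fits g w]].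

Lemma gap_okP g : reflect (gapok nu pi (fun j => g j)) (gap_ok g).
Proof. exact: forallP. Qed.

Lemma fitsP g w : reflect ((forall x, x \notin edges s -> w x = [::] :> seq letter) /\
  {in edges s, forall x, wdisp (w x) = edge_disp (fun j => g j) x}) (fits g w).
Proof.
apply: (iffP forallP) => [h|[h1 h2] x].
  split=> x xE; have := h x; rewrite /fits1; first by rewrite (negbTE xE) => /eqP ->.
  by rewrite xE => /eqP.
rewrite /fits1; have [xE|xE] := boolP (x \in edges s); first by rewrite h2.
by apply/eqP; apply: val_inj; exact: h1.
Qed.

Lemma gap_wordsE N : (N <= B)%N ->
  Rpi_count nu pi (n_leaves s + N) = #|gap_words N|.
Proof.
move=> leNB; apply: (Rpi_count_words gs leNB) => w; split.
  rewrite inE => /andP[/eqP wN /existsP[g /andP[/gap_okP ok /fitsP[h1 h2]]]].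
  split=> //; exists (gap_label l0 rk (fun j => g j)); split.
    exact/(gap_labeling l0_rot).
  exact: (gapok_order l0 piK nu_inj ok).
move=> [h1 wN [l [lab ho]]]; rewrite inE -{1}wN eqxx /=.
have [g ok h2] := labeling_gap l0_rot rkK piK lab ho.
have gB j : (g j < B.+2)%N.
  rewrite ltnS; apply: leq_trans (gap_bound gs l0_rot rkK piK hcons j (M := N) ok _) _ => //.
  move=> x xE; rewrite -h2 //; apply: leq_trans (wdisp_size _) _.
  by rewrite -wN (bigD1 x) //= leq_addr.
have gE : (fun j => [ffun j => Ordinal (gB j)] j : nat) =1 g by move=> j; rewrite ffunE.
apply/existsP; exists [ffun j => Ordinal (gB j)]; apply/andP; split.
  by apply/gap_okP => j; rewrite ffunE; exact: ok.
by apply/fitsP; split=> // x xE; rewrite h2 //; apply/esym/eq_edge_disp.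
Qed.

Lemma gap_words_unique g g' w : fits g w -> fits g' w -> g = g'.
Proof.
move=> /fitsP[_ h] /fitsP[_ h']; apply/ffunP => j; apply: val_inj.
apply: (gap_unique gs piK (l0 := l0) (g := fun j => g j) (g' := fun j => g' j)).
by move=> x xE; rewrite -h // -h'.
Qed.

Definition gap_poly : {poly rat} :=
  \sum_(g | gap_ok g) \prod_(x in edges s) word_poly B (edge_disp (fun j => g j) x).

Lemma gap_polyE g : \prod_(x in edges s) word_poly B (edge_disp (fun j => g j) x)
  = \sum_(w | fits g w) 'X^(word_size w).
Proof.
rewrite big_mkcond /=.
transitivity (\prod_x \sum_(a : B.-bseq letter)
    if fits1 g x a then 'X^(size a) else 0 : {poly rat}).
  apply: eq_bigr => x _; rewrite /fits1 /word_poly; case: ifP => // _.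
  by rewrite (bigD1 [bseq]) //= big1 ?addr0 // => a /negbTE->.
rewrite bigA_distr_bigA [RHS]big_mkcond; apply: eq_bigr => w _.
have [fw|] := boolP (fits g w); last first.
  rewrite negb_forall => /existsP[x nx].
  by rewrite (bigD1 x) //= (negbTE nx) mul0r.
rewrite (eq_bigr (fun x => 'X^(size (w x)))); last first.
  by move=> x _; have /forallP/(_ x) -> := fw.
rewrite -expr_sum /word_size [in RHS]big_mkcond; congr ('X^_).
apply: eq_bigr => x _; case: ifPn => // xE.
by have /fitsP[h _] := fw; rewrite h.
Qed.

(** [gap_poly] counts pairs of a gap sequence and a fitting family of words. By [gap_words_unique] a
    family fits at most one sequence, so nothing is counted twice. *)
Lemma coef_gap_poly N : gap_poly`_N = #|gap_words N|%:R.
Proof.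
rewrite /gap_poly coef_sum.
under eq_bigr => g _ do rewrite gap_polyE coef_sum big_mkcond.
rewrite exchange_big -sum1_card natr_sum [RHS]big_mkcond /=.
apply: eq_bigr => w _; rewrite inE.
have [/existsP[g0 /andP[ok fw]]|] := boolP [exists g, gap_ok g && fits g w].
  rewrite (bigD1 g0) //= fw coefXn eq_sym andbT big1 ?addr0; first by case: eqP.
  move=> g /andP[_ ne]; case: ifP => // /gap_words_unique/(_ fw) e.
  by rewrite e eqxx in ne.
rewrite negb_exists andbF => /forallP h; rewrite big1 // => g ok.
by have := h g; rewrite ok /= => /negbTE->.
Qed.

Lemma total_disp_gap g : gap_ok g -> total_disp (fun j => g j) =
  (total_disp (fun j => desc j) + \sum_(j < n) crossing j * (g j - desc j))%N.
Proof.
move=> /gap_okP ok; apply/eqP; rewrite -eqz_nat PoszD.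
have ok' : gapok nu pi (fun j => desc j) by move=> j.
rewrite (total_dispE gs l0_rot rkK hcons ok) (total_dispE gs l0_rot rkK hcons ok').
rewrite addrAC; apply/eqP; congr (_ + _).
rewrite -[X in _ = _ + X]natz natr_sum -big_split; apply: eq_bigr => j _ /=.
by rewrite natz -PoszD -mulnDr subnKC //; exact: ok.
Qed.

(** The sum over gap sequences factors into truncated geometric series, with [B + 1] terms at a
    descent and [B + 2] elsewhere. Their remainders vanish at this precision, since [D] has no
    constant term and every crossing number is positive. *)
Lemma gap_poly_D (D : {poly rat}) : D`_0 = 0 ->
  eqX B.+1 (\prod_(j < n) (1 - D ^+ crossing j) *
     \sum_(g | gap_ok g) D ^+ total_disp (fun j => g j))
   (D ^+ total_disp (fun j => desc j)).
Proof.
move=> D0.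
have -> : \sum_(g | gap_ok g) D ^+ total_disp (fun j => g j) =
   D ^+ total_disp (fun j => desc j) * \prod_(j < n) \sum_(i < B.+2)
     if (desc j <= i)%N then D ^+ (crossing j * (i - desc j)) else 0.
  rewrite bigA_distr_bigA mulr_sumr big_mkcond; apply: eq_bigr => g _.
  case: ifPn => [ok|].
    rewrite total_disp_gap // exprD; congr (_ * _); rewrite expr_sum.
    by apply: eq_bigr => j _; have /gap_okP/(_ j) -> := ok.
  by rewrite negb_forall => /existsP[j /negbTE h]; rewrite (bigD1 j) //= h mul0r mulr0.
rewrite mulrCA -big_split /= -[X in eqX _ _ X]mulr1; apply: eqXM => //.
apply: (eqX_trans (q := \prod_(j < n) 1)); last by rewrite big1.
apply: eqX_prod => j _; have c0 := crossing_gt0 gs piK j.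
set q := D ^+ crossing j.
have geom k : (B < k)%N -> eqX B.+1 ((1 - q) * \sum_(i < k) q ^+ i) 1.
  move=> ltk; have -> : (1 - q) * \sum_(i < k) q ^+ i = 1 - q ^+ k.
    by rewrite -[RHS]opprB subrX1 -mulNr opprB.
  rewrite -[X in eqX _ _ X]subr0; apply: eqXD => //; apply: eqXN.
  rewrite -exprM; apply: eqX0_exp => //.
  by apply: leq_trans ltk _; rewrite leq_pmull.
case: (desc j) => /=.
  rewrite big_ord_recl add0r.
  under eq_bigr => i _ do rewrite /= /bump /= add1n subSS subn0 exprM.
  exact: geom.
under eq_bigr => i _ do rewrite subn0 exprM.
exact: geom.
Qed.

Lemma gap_poly_series N : (B < N)%N ->
  eqX B.+1 ((1 - Dpoly N ^+ 2) ^+ #|edges s| *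
      \prod_(j < n) (1 - Dpoly N ^+ crossing j) * gap_poly)
   (kappa (Dpoly N) ^+ #|edges s| * Dpoly N ^+ total_disp (fun j => desc j)).
Proof.
move=> ltBN; set D := Dpoly N.
apply: (eqX_trans (q := \prod_(j < n) (1 - D ^+ crossing j) * (kappa D ^+ #|edges s| *
   \sum_(g | gap_ok g) D ^+ total_disp (fun j => g j)))); last first.
  by rewrite mulrCA; apply: eqXM => //; apply: gap_poly_D; exact: Dpoly0.
rewrite mulrAC mulrC; apply: eqXM => //; rewrite /gap_poly !mulr_sumr.
apply: eqX_sum => g ok; rewrite -!prodr_const [_ ^+ total_disp _]expr_sum -!big_split /=.
by apply: eqX_prod => x xE; exact: word_polyE.
Qed.

End Words.

(** Here t = D / kappa(D) has been substituted: the factor t^(L+1) puts X^(L+1) in the numerator and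
    kappa^(L+1) in the denominator. Powers of [kappa] are left uncancelled, so that the substitution
    of 1/X acts factor by factor. *)
Definition series_num : {poly rat} :=
  'X ^+ ((n_leaves s).+1 + total_disp (fun j => desc j)) * kappa 'X ^+ #|edges s|.
Definition series_den : {poly rat} :=
  (1 - 'X^2) ^+ #|edges s| * \prod_(j < n) (1 - 'X^(crossing j)) *
  kappa 'X ^+ (n_leaves s).+1.

Lemma kappa_comp (D : {poly rat}) : kappa 'X \Po D = kappa D.
Proof.
by rewrite /kappa !comp_polyD comp_polyZ comp_polyX comp_Xn_poly -[1]polyC1 comp_polyC.
Qed.

Lemma subX_comp (D : {poly rat}) k : (1 - 'X^k) \Po D = 1 - D ^+ k.
Proof. by rewrite comp_polyB comp_Xn_poly -[1]polyC1 comp_polyC. Qed.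

Lemma Rseries_gap_poly B :
  eqX B.+1 (truncation (Rseries nu pi) B.+1) ('X ^+ (n_leaves s).+1 * gap_poly B).
Proof.
move=> i lti; rewrite coef_poly lti coefXnM.
case: i lti => [|k] ltk /=; first by [].
rewrite ltnS; case: ltnP => [lt|le]; first by rewrite Rpi_count0.
rewrite subSS coef_gap_poly -gap_wordsE ?subnKC //.
by apply: leq_trans (leq_subr _ _) _; exact: ltnW.
Qed.

Lemma series_den_neq0 : series_den != 0.
Proof.
have h (p : {poly rat}) : p`_0 = 1 -> p != 0.
  by move=> p0; apply: contra_eq_neq p0 => ->; rewrite coef0 eq_sym oner_neq0.
have h1 k : (0 < k)%N -> 1 - 'X^k != 0 :> {poly rat}.
  by move=> k0; apply: h; rewrite coefB coef1 coefXn /= eq_sym -[k == 0%N]negbK -lt0n k0 subr0.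
rewrite !mulf_neq0 ?expf_neq0 //; first exact: h1.
- apply/prodf_neq0 => j _; apply: h1; exact: (crossing_gt0 gs piK).
by apply: h; rewrite !coefD coefZ coef1 coefX coefXn /= mulr0 !addr0.
Qed.

Lemma Rseries_rational :
  rational_in_D (Rseries nu pi) (series_num%:F / series_den%:F).
Proof.
apply: rational_in_D_frac; first exact: series_den_neq0.
case=> [//|B]; set D := Dpoly B.+1.
have denE : series_den \Po D = (1 - D ^+ 2) ^+ #|edges s| *
    \prod_(j < n) (1 - D ^+ crossing j) * kappa D ^+ (n_leaves s).+1.
  rewrite /series_den !rmorphM !rmorphXn rmorph_prod /= subX_comp kappa_comp.
  by congr (_ * _ * _); apply: eq_bigr => j _; exact: subX_comp.
have numE : series_num \Po D = D ^+ ((n_leaves s).+1 + total_disp (fun j => desc j)) *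
    kappa D ^+ #|edges s|.
  by rewrite /series_num rmorphM !rmorphXn /= comp_polyX kappa_comp.
rewrite denE numE.
apply: (eqX_trans (eqXM (eqX_refl _) (@Rseries_gap_poly B))).
rewrite [_ * gap_poly B]mulrC mulrACA -exprMn.
have e1 := @gap_poly_series B B.+1 (ltnSn B).
have e2 : eqX B.+1 ((kappa D * 'X) ^+ (n_leaves s).+1) (D ^+ (n_leaves s).+1).
  by apply: eqX_exp; rewrite mulrC; apply: eqX_sym; exact: (@DpolyE B.+1).
apply: (eqX_trans (eqXM e1 e2)).
by rewrite exprD mulrC [kappa _ ^+ _ * _]mulrC mulrA.
Qed.

End Series.

(** * Reversal of the height order *)

Lemma kappa_inv (K : fieldType) (x : K) : x != 0 ->
  1 + x^-1 *+ 4 + x^-1 ^+ 2 = (1 + x *+ 4 + x ^+ 2) * x^-1 ^+ 2.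
Proof. by move=> x0; field. Qed.

Section Reversal.
Variables (S : finType) (s : bmap S) (l0 : S -> int).
Hypotheses (gs : good_scheme s).
Hypothesis l0_rot : forall x, l0 (rot s x) = l0 x + updown (rot s x \in out s).
Variables (n : nat) (nu : vertex s -> 'I_n.+1) (pi : 'I_n.+1 -> vertex s).
Variable rk : vertex s -> 'I_n.+1.
Hypotheses (rkK : cancel rk pi) (piK : cancel pi rk).
Hypothesis nu_inj : injective nu.
Hypothesis hcons : forall u v, offset_toward l0 u v -> (nu u < nu v)%N.

Let pib k := pi (rev_ord k).
Let rkb v := rev_ord (rk v).

Lemma rev_rkK : cancel rkb pib.
Proof. by move=> v; rewrite /pib /rkb rev_ordK rkK. Qed.

Lemma rev_piK : cancel pib rkb.
Proof. by move=> k; rewrite /pib /rkb piK rev_ordK. Qed.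

Lemma crossing_rev j : crossing rkb j = crossing rk (rev_ord j).
Proof.
apply: eq_bigr => x _; congr (nat_of_bool _); rewrite /between /=.
have := ltn_ord (rk (vertex_of s x)); have := ltn_ord (rk (vertex_of s (mate s x))).
by have := ltn_ord j; lia.
Qed.

Lemma offset_rev x : offset l0 rkb x = - offset l0 rk x.
Proof.
rewrite /offset /=.
have := ltn_ord (rk (vertex_of s x)); have := ltn_ord (rk (vertex_of s (mate s x))).
by do 4?case: ifP; lia.
Qed.

Lemma desc_rev j : desc nu pib (rev_ord j) = ~~ desc nu pi j.
Proof.
rewrite /desc /pib.
have -> : rev_ord (above (rev_ord j)) = below j.
  by apply: val_inj; rewrite /= /bump; have := ltn_ord j; lia.
have -> : rev_ord (below (rev_ord j)) = above j.
  by apply: val_inj; rewrite /= /bump; have := ltn_ord j; lia.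
rewrite -leqNgt ltn_neqAle; have -> // : nu (pi (below j)) != nu (pi (above j)) :> nat.
by rewrite val_eqE (inj_eq nu_inj) (inj_eq (can_inj piK)) -val_eqE /= /bump; lia.
Qed.

(** The offsets of an order and of its reversal cancel, and each gap is a descent for exactly one of
    the two orders. *)
Lemma total_disp_rev :
  (total_disp l0 rk (fun j => desc nu pi j) + total_disp l0 rkb (fun j => desc nu pib j)
   = \sum_(j < n) crossing rk j)%N.
Proof.
apply/eqP; rewrite -eqz_nat PoszD.
rewrite (total_dispE gs l0_rot rkK hcons) // (total_dispE gs l0_rot rev_rkK hcons) //.
have -> : total_offset l0 rkb = - total_offset l0 rk.
  by rewrite /total_offset -sumrN; apply: eq_bigr => x _; exact: offset_rev.
rewrite addrACA subrr addr0 -[X in _ == X]natz natr_sum.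
rewrite [X in _ + X](reindex_inj rev_ord_inj) -big_split /=.
apply/eqP; apply: eq_bigr => j _.
by rewrite crossing_rev rev_ordK desc_rev natz; case: (desc _ _ _); lia.
Qed.

Let F : {fraction {poly rat}} :=
  (series_num l0 nu pi rk)%:F / (series_den rk)%:F.
Let Fb : {fraction {poly rat}} :=
  (series_num l0 nu pib rkb)%:F / (series_den rkb)%:F.

(** [kappa 'X] is a palindromic polynomial of degree 2. *)
Lemma ev_inv_kappa : ev_inv (kappa 'X) = (kappa 'X)%:F * Xinv ^+ 2.
Proof.
have X0 : ('X : {poly rat})%:F != 0 by rewrite tofrac_eq0 polyX_eq0.
rewrite /kappa scaler_nat.
have e (g : {rmorphism {poly rat} -> {fraction {poly rat}}}) :
    g (1 + 'X *+ 4 + 'X^2) = 1 + g 'X *+ 4 + g 'X ^+ 2.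
  by rewrite (rmorphD g) (rmorphD g) (rmorphMn g) (rmorphXn g) (rmorph1 g).
by rewrite !e /= ev_invX kappa_inv.
Qed.

(** The source of the signs: the denominator contains #|[edges s]| + [n] factors of this form. *)
Lemma ev_inv_subX k : ev_inv (1 - 'X^k) = - (1 - 'X^k)%:F * Xinv ^+ k.
Proof.
have X0 : ('X : {poly rat})%:F != 0 by rewrite tofrac_eq0 polyX_eq0.
rewrite !rmorphB !rmorphXn !rmorph1 /= ev_invX opprB mulrBl mul1r /Xinv.
by rewrite -exprMn mulfV // expr1n.
Qed.

Lemma series_reversal : frac_eval Fb ('X%:F)^-1 = F.
Proof.
have X0 : ('X : {poly rat})%:F != 0 by rewrite tofrac_eq0 polyX_eq0.
rewrite /Fb /F frac_eval_inv; last exact: (series_den_neq0 gs rev_piK).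
apply/eqP; rewrite eqr_div ?ev_inv_neq0 ?tofrac_eq0 ?(series_den_neq0 gs rev_piK)
  ?(series_den_neq0 gs piK) //.
set E := #|edges s|; set L := (n_leaves s).+1.
set e := total_disp l0 rk (fun j => desc nu pi j).
set eb := total_disp l0 rkb (fun j => desc nu pib j).
pose T : {fraction {poly rat}} := \prod_(j < n) (1 - 'X^(crossing rk j))%:F.
pose K := (kappa 'X)%:F; pose A := (1 - 'X^2 : {poly rat})%:F.
have dE : (series_den rk)%:F = A ^+ E * T * K ^+ L.
  by rewrite /series_den !rmorphM !rmorphXn rmorph_prod.
have nE : (series_num l0 nu pi rk)%:F = 'X%:F ^+ (L + e) * K ^+ E.
  by rewrite /series_num rmorphM !rmorphXn.
have nbE : ev_inv (series_num l0 nu pib rkb) = Xinv ^+ (L + eb) * (K * Xinv ^+ 2) ^+ E.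
  by rewrite /series_num rmorphM !rmorphXn /= ev_invX ev_inv_kappa.
have TbE : ev_inv (\prod_(j < n) (1 - 'X^(crossing rkb j))) =
    (-1) ^+ n * T * Xinv ^+ (\sum_(j < n) crossing rk j).
  rewrite rmorph_prod /= (reindex_inj rev_ord_inj) /= expr_sum -[X in (-1) ^+ X]card_ord.
  rewrite -prodr_const -!big_split /=; apply: eq_bigr => j _.
  by rewrite crossing_rev rev_ordK ev_inv_subX mulN1r.
have dbE : ev_inv (series_den rkb) = (- A * Xinv ^+ 2) ^+ E *
    ((-1) ^+ n * T * Xinv ^+ (\sum_(j < n) crossing rk j)) * (K * Xinv ^+ 2) ^+ L.
  by rewrite /series_den !rmorphM !rmorphXn /= TbE ev_inv_kappa ev_inv_subX.
have sgn : (-1) ^+ E * (-1) ^+ n = 1 :> {fraction {poly rat}}.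
  rewrite -exprD -signr_odd.
  have := scheme_parity gs; have -> : #|vertex s| = n.+1.
    by rewrite -(card_ord n.+1); apply: bij_eq_card; exists pi; [exact: rkK | exact: piK].
  by rewrite addnS /= => /negbTE->.
(* The balance of the powers of X, by [total_disp_rev]. The factors X^(-2E) coming from [kappa] in
   the numerator and from 1 - X^2 in the denominator agree and need no accounting. *)
have XV : 'X%:F ^+ (L + e) * Xinv ^+ (\sum_(j < n) crossing rk j) * (Xinv ^+ 2) ^+ L
    = Xinv ^+ (L + eb).
  rewrite -exprM -mulrA -exprD -total_disp_rev -/e -/eb.
  have -> : (e + eb + 2 * L = (L + e) + (L + eb))%N by lia.
  by rewrite (exprD _ (L + e) (L + eb)) mulrA /Xinv -exprMn mulfV // expr1n mul1r.
rewrite dE nE nbE dbE -XV -[- A]mulN1r !exprMn.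
rewrite -[X in X == _]mul1r -{1}sgn; apply/eqP.
move: ((-1) ^+ E) ((-1) ^+ n) ('X%:F ^+ (L + e)) (Xinv ^+ \sum_(j < n) _) => a b c d.
by ring.
Qed.

End Reversal.

Theorem theorem6p1 (S : finType) (s : bmap S) (hs : unlabeled_scheme s)
    (n : nat) (hn : #|vertex s| = n)
    (nu : vertex s -> 'I_n) (hnu : bijective nu) (hcons : consistent nu)
    (pi : 'I_n -> vertex s) (hpi : bijective pi) :
  exists F Fbar : {fraction {poly rat}},
    [/\ rational_in_D (Rseries nu pi) F,
        rational_in_D (Rseries nu (fun k => pi (rev_ord k))) Fbar
      & frac_eval Fbar ('X%:F)^-1 = F].
Proof.
have [l0 hl0] := hs; have [m [r [f [rR emb _]]]] := hl0.
have gs := emb_good rR emb.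
have l0_rot x := labeled_scheme_rot x hl0.
case: n => [|n] in hn nu hnu hcons pi hpi *.
  (* The vertex of the root excludes the empty case, so that [n.+1] vertices leave [n] gaps. *)
  by have /card0_eq/(_ (vertex_of s (root s))) := hn.
have [rk piK rkK] := hpi; have nu_inj := bij_inj hnu; have hc := hcons l0 hl0.
exists ((series_num l0 nu pi rk)%:F / (series_den rk)%:F).
exists ((series_num l0 nu (fun k => pi (rev_ord k)) (fun v => rev_ord (rk v)))%:F
        / (series_den (fun v => rev_ord (rk v)))%:F).
split.
- exact: (Rseries_rational gs l0_rot rkK piK nu_inj hc).
- exact: (Rseries_rational gs l0_rot (rev_rkK rkK) (rev_piK piK) nu_inj hc).
exact: (series_reversal gs l0_rot rkK piK nu_inj hc).
Qed.
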